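(* Let $\mathcal{S}$ be a pseudo-regular subspace of a Krein space $\mathcal{H}$ with fundamental symmetry $J$, and let $\mathcal{M}_0$ be a regular subspace such that $\mathcal{S}=\mathcal{M}_0[\dot{+}]\mathcal{S}^{\circ}$. Let $Q_0$ be a fixed projection in $\mathcal{Q}_{\mathcal{S},\mathcal{M}_0}$. Let $g:\mathcal{F}\to\mathcal{Q}_{\mathcal{S}}$ be the continuous selection and $s:\mathcal{Q}_{\mathcal{S}}\to\mathcal{U}_{\mathcal{S}}$ the global continuous cross section of $U\mapsto UQ_0U^{\#}$ specified in the context. Consider the map $r:\mathcal{Q}_{\mathcal{S}}\to\mathcal{Q}_{\mathcal{S},\mathcal{M}_0}$ defined by $$r(Q)=s(g(\mathcal{M}))^{\#}\,Q\,s(g(\mathcal{M}))\quad\text{whenever } Q\in\mathcal{Q}_{\mathcal{S},\mathcal{M}},\ \mathcal{M}\in\mathcal{F}.$$ Then $r$ is a covering map.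
   Context: $(\mathcal{H},\langle\cdot,\cdot\rangle)$ is a complex separable Hilbert space, $L(\mathcal{H})$ its algebra of bounded operators, $J\in L(\mathcal{H})$ a fixed symmetry ($J=J^*=J^{-1}$), $[f,g]=\langle Jf,g\rangle$, and $T^{\#}=JT^*J$. $R(T)$ denotes the range of $T$. For a subspace $\mathcal{S}$, $\mathcal{S}^{[\perp]}=\{f:[f,g]=0\ \forall g\in\mathcal{S}\}$, $\mathcal{S}^{\circ}=\mathcal{S}\cap\mathcal{S}^{[\perp]}$, and $[\dot{+}]$ is $J$-orthogonal direct sum. A closed subspace $\mathcal{M}$ is regular if $\mathcal{M}[\dot{+}]\mathcal{M}^{[\perp]}=\mathcal{H}$; then there is a unique $J$-selfadjoint projection $E_{\mathcal{M}}$ (i.e. $E_{\mathcal M}^2=E_{\mathcal M}=E_{\mathcal M}^{\#}$) with range $\mathcal{M}$. A closed subspace $\mathcal{S}$ is pseudo-regular if $\mathcal{S}=\mathcal{S}^{\circ}[\dot{+}]\mathcal{M}$ for some regular $\mathcal{M}$. $\mathcal{Q}_{\mathcal{S}}=\{Q\in L(\mathcal{H}):Q^2=Q,\ QQ^{\#}=Q^{\#}Q,\ R(Q)=\mathcal{S}\}$ with the norm topology inherited from $L(\mathcal{H})$. $\mathcal{F}$ is the set of regular subspaces $\mathcal{M}$ with $\mathcal{S}=\mathcal{M}[\dot{+}]\mathcal{S}^{\circ}$, with metric $d(\mathcal{M},\mathcal{N})=\|E_{\mathcal{M}}-E_{\mathcal{N}}\|$. For $\mathcal{M}\in\mathcal{F}$,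 $\mathcal{Q}_{\mathcal{S},\mathcal{M}}=\{Q\in\mathcal{Q}_{\mathcal{S}}:R(QQ^{\#})=\mathcal{M}\}$, with the inherited topology; $\mathcal{Q}_{\mathcal{S}}$ is the disjoint union of the sets $\mathcal{Q}_{\mathcal{S},\mathcal{M}}$, $\mathcal{M}\in\mathcal{F}$. $\mathcal{U}_{\mathcal{S}}=\{U\in L(\mathcal{H}):UU^{\#}=U^{\#}U=I,\ U(\mathcal{S})=\mathcal{S}\}$ with the norm topology. The selection $g$: with respect to the orthogonal decomposition $\mathcal{H}=\mathcal{S}^{\circ}\oplus(\mathcal{S}\ominus\mathcal{S}^{\circ})\oplus\mathcal{S}^{\perp}$ write $$J=\begin{pmatrix}0&0&a\\ 0&b&c\\ {a^*}&c^*&d\end{pmatrix}$$ ($b$ is invertible). For $\mathcal{M}\in\mathcal{F}$ let $\rho=\rho(\mathcal{M})\in L(\mathcal{S}^{\perp},\mathcal{S}\ominus\mathcal{S}^{\circ})$ be the operator equal to $P_{\mathcal{S}\ominus\mathcal{S}^{\circ}}E_{\mathcal{M}}$ on $J(\mathcal{S}^{\circ})\subseteq\mathcal{S}^{\perp}$ and to $0$ on $\mathcal{S}^{\perp}\ominus J(\mathcal{S}^{\circ})$, where $P_{\mathcal{S}\ominus\mathcal{S}^{\circ}}$ is the orthogonal projection. Then $g:\mathcal{F}\to\mathcal{Q}_{\mathcal{S}}$ is the continuous map $$g(\mathcal{M})=\begin{pmatrix}I&0&-\tfrac12 a\rho^*b^3\rho a^*a+a\rho^*(c+b\rho)\\ 0&I&b^{-1}c+\rho\\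 0&0&0\end{pmatrix},$$ which satisfies $g(\mathcal{M})\in\mathcal{Q}_{\mathcal{S},\mathcal{M}}$. The section $s$: for $Q\in\mathcal{Q}_{\mathcal{S}}$ put $E=QQ^{\#}$, $P=Q(I-Q^{\#})$, $F=(I-Q)(I-Q)^{\#}$, and let $E_0,P_0,F_0$ be the corresponding operators for $Q_0$. Then $R(P)=R(P_0)=\mathcal{S}^{\circ}$, $\mathcal{H}=R(E_0)[\dot{+}]R(P_0+P_0^{\#})[\dot{+}]R(F_0)$, $\mathcal{S}=R(E)[\dot{+}]\mathcal{S}^{\circ}$ and $\mathcal{S}^{[\perp]}=R(F)[\dot{+}]\mathcal{S}^{\circ}$. Let $P_{R(E)//\mathcal{S}^{\circ}}\in L(\mathcal{S})$ be the projection with range $R(E)$ and nullspace $\mathcal{S}^{\circ}$, and $P_{R(F)//\mathcal{S}^{\circ}}\in L(\mathcal{S}^{[\perp]})$ the projection with range $R(F)$ and nullspace $\mathcal{S}^{\circ}$. Let $V(Q)$ be the operator on $R(P_0+P_0^{\#})=\mathcal{S}^{\circ}\dot{+}R(P_0^{\#})$ given by $V(Q)(f+P_0^{\#}Jh)=f+P^{\#}Jh$ for $f,h\in\mathcal{S}^{\circ}$ (note that $h\mapsto P_0^{\#}Jh$ is an isomorphism of $\mathcal{S}^{\circ}$ onto $R(P_0^{\#})$). Then $$s(Q)=P_{R(E)//\mathcal{S}^{\circ}}E_0+P_{R(F)//\mathcal{S}^{\circ}}F_0+V(Q)(P_0+P_0^{\#}),$$ which is a continuous map $s:\mathcal{Q}_{\mathcal{S}}\to\mathcal{U}_{\mathcal{S}}$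 with $s(Q)Q_0s(Q)^{\#}=Q$.
   Formalization: In the norm topology r is not a covering map if S°≠0 and S≠S° (fibres are homeomorphic to F, not discrete); here sheets are open in the sets Q_{S,M}, not in Q_S: r is norm continuous, onto, and a covering for the disjoint union topology. *)

(* Defs.v *)
From HB Require Import structures.
From mathcomp Require Import all_boot all_order all_algebra.
From mathcomp Require Import all_classical all_reals all_analysis.
From mathcomp Require Import sesquilinear complex.

Set Implicit Arguments.
Unset Strict Implicit.
Unset Printing Implicit Defensive.

Import Order.TTheory GRing.Theory Num.Def Num.Theory.
Import numFieldNormedType.Exports.

Local Open Scope classical_set_scope.
Local Open Scope complex_scope.
Local Open Scope ring_scope.

(** * The algebra of bounded operators, with the operator norm *)

Section BoundedOperators.
Context {R : realType} {H : normedModType R[i]}.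

Definition is_bounded_operator : {pred H -> H} :=
  fun f => `[< linear f /\ continuous f >].

Record bounded_operator := BoundedOperator {
  bounded_operator_fun :> H -> H ;
  bounded_operatorP : bounded_operator_fun \in is_bounded_operator }.

HB.instance Definition _ := [isSub for bounded_operator_fun].
HB.instance Definition _ := [Choice of bounded_operator by <:].

Lemma bop_linear (T : bounded_operator) : linear T.
Proof. by have /asboolP[] := bounded_operatorP T. Qed.

Lemma bop_continuous (T : bounded_operator) : continuous T.
Proof. by have /asboolP[] := bounded_operatorP T. Qed.

HB.instance Definition _ (T : bounded_operator) :=
  GRing.isLinear.Build R[i] H H *:%R T (@bop_linear T).

Lemma bop_eqP (S T : bounded_operator) : S =1 T <-> S = T.
Proof. by split=> [ST|->//]; apply/val_inj/funext. Qed.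

Fact is_bounded_operator_submod : submod_closed is_bounded_operator.
Proof.
split.
  apply/asboolP; split; last by move=> x; exact: cst_continuous.
  by move=> c x y; rewrite scaler0 addr0.
move=> c f g /asboolP[lf cf] /asboolP[lg cg]; apply/asboolP; split.
  move=> d x y; rewrite !fctE/= lf lg !scalerDr !scalerA (mulrC d c).
  by rewrite addrACA.
by move=> x; apply: cvgD; [apply: cvgZr; exact: cf|exact: cg].
Qed.

HB.instance Definition _ :=
  GRing.isSubmodClosed.Build R[i] (H -> H) is_bounded_operator
    is_bounded_operator_submod.
HB.instance Definition _ :=
  [SubChoice_isSubLmodule of bounded_operator by <:].

Fact bop_comp_subproof (S T : bounded_operator) :
  (S \o T : H -> H) \in is_bounded_operator.
Proof.
apply/asboolP; split; first by move=> c x y; rewrite /= !linearP.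
by move=> x; apply: continuous_comp; apply: bop_continuous.
Qed.

Definition bop_comp (S T : bounded_operator) : bounded_operator :=
  BoundedOperator (bop_comp_subproof S T).

Fact bop_id_subproof : (@idfun H) \in is_bounded_operator.
Proof. by apply/asboolP; split=> [c x y//|x]; exact: cvg_id. Qed.

Definition bop_id : bounded_operator := BoundedOperator bop_id_subproof.

Fact bop_compA : associative bop_comp.
Proof. by move=> S T U; apply/val_inj. Qed.

Fact bop_comp1l : left_id bop_id bop_comp.
Proof. by move=> S; apply/val_inj. Qed.

Fact bop_comp1r : right_id bop_id bop_comp.
Proof. by move=> S; apply/val_inj. Qed.

Fact bop_compDl : left_distributive bop_comp +%R.
Proof. by move=> S T U; apply/val_inj. Qed.

Fact bop_compDr : right_distributive bop_comp +%R.
Proof. by move=> S T U; apply/bop_eqP => x /=; rewrite linearD. Qed.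

HB.instance Definition _ := GRing.Zmodule_isPzRing.Build bounded_operator
  bop_compA bop_comp1l bop_comp1r bop_compDl bop_compDr.

Lemma bop_mulE (S T : bounded_operator) x : (S * T) x = S (T x).
Proof. by []. Qed.

Lemma bop_oneE x : (1 : bounded_operator) x = x.
Proof. by []. Qed.

Lemma bop_addE (S T : bounded_operator) x : (S + T) x = S x + T x.
Proof. by []. Qed.

Lemma bop_scaleE c (T : bounded_operator) x : (c *: T) x = c *: T x.
Proof. by []. Qed.

(* Norms on [H] take values in [R[i]], whereas suprema are taken in [R]. *)
Definition opnorm_set (T : bounded_operator) : set R :=
  [set complex.Re `|T x| | x in [set x : H | `|x| <= 1]].

Definition opnorm (T : bounded_operator) : R[i] := (sup (opnorm_set T))%:C.

Let ReK (z : R[i]) : 0 <= z -> z = (complex.Re z)%:C.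
Proof. by move=> z0; rewrite RRe_real// ger0_real. Qed.

Fact opnorm_set_has_sup (T : bounded_operator) : has_sup (opnorm_set T).
Proof.
split; first by exists (complex.Re `|T 0|), 0 => //=; rewrite normr0.
have /linear_boundedP : bounded_near T (nbhs 0).
  by apply: continuous_linear_bounded; apply: bop_continuous.
move=> /pinfty_ex_gt0[M M0 TM]; exists (complex.Re M) => _ [x /= x1 <-].
rewrite -lecR -ReK// -ReK ?(ltW M0)//.
by rewrite (le_trans (TM x))// ger_pMr.
Qed.

Fact opnorm_ge (T : bounded_operator) x : `|x| <= 1 -> `|T x| <= opnorm T.
Proof.
move=> x1; rewrite (ReK (normr_ge0 _)) lecR.
by apply: (sup_upper_bound (opnorm_set_has_sup T)); exists x.
Qed.

Fact opnorm_le (T : bounded_operator) (M : R[i]) : 0 <= M ->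
  (forall x, `|x| <= 1 -> `|T x| <= M) -> opnorm T <= M.
Proof.
move=> M0 TM; rewrite /opnorm (ReK M0) lecR.
apply: ge_sup; first by case: (opnorm_set_has_sup T).
by move=> _ [x /= x1 <-]; rewrite -lecR -!ReK ?TM.
Qed.

Fact opnorm_ge0 (T : bounded_operator) : 0 <= opnorm T.
Proof. by apply: le_trans (@opnorm_ge T 0 _); rewrite ?normr0. Qed.

Fact opnormD (S T : bounded_operator) : opnorm (S + T) <= opnorm S + opnorm T.
Proof.
apply: opnorm_le => [|x x1]; first by rewrite addr_ge0 ?opnorm_ge0.
by rewrite bop_addE (le_trans (ler_normD _ _))// lerD ?opnorm_ge.
Qed.

Fact opnormZ (c : R[i]) (T : bounded_operator) :
  opnorm (c *: T) = `|c| * opnorm T.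
Proof.
have le d U : opnorm (d *: U) <= `|d| * opnorm U.
  apply: opnorm_le => [|x x1]; first by rewrite mulr_ge0 ?opnorm_ge0.
  by rewrite bop_scaleE normrZ ler_wpM2l ?opnorm_ge.
apply/eqP; rewrite eq_le le/=; have [->|c0] := eqVneq c 0.
  by rewrite normr0 mul0r opnorm_ge0.
rewrite -ler_pdivlMl ?normr_gt0// -normfV.
by rewrite -{1}[T](scalerK c0) le.
Qed.

Fact opnorm0_eq0 (T : bounded_operator) : opnorm T = 0 -> T = 0.
Proof.
move=> T0; apply/bop_eqP => x; apply/normr0_eq0/eqP.
have [->|x0] := eqVneq x 0; first by rewrite linear0 normr0.
have : `|T (`|x|^-1 *: x)| <= opnorm T.
  by rewrite opnorm_ge// normrZ normfV normr_id mulVf// normr_eq0.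
rewrite T0 linearZ normrZ normfV normr_id pmulr_rle0 ?invr_gt0 ?normr_gt0//.
by rewrite normr_le0 normr_eq0.
Qed.

HB.instance Definition _ := Lmodule_isNormed.Build R[i] bounded_operator
  opnormD opnormZ opnorm0_eq0.

End BoundedOperators.
Arguments bounded_operator {R} H.

Notation "''L' ( H )" := (bounded_operator H) (format "''L' ( H )") : type_scope.

Definition separable (T : topologicalType) : Prop :=
  exists D : set T, countable D /\ dense D.

(** * Covering maps *)

Section CoveringMaps.
Context {T T' : topologicalType}.

Definition relatively_open (X : set T) (W : set T) : Prop :=
  exists2 O : set T, open O & W = X `&` O.

Definition homeomorphism_on (W : set T) (V : set T') (p : T -> T') : Prop :=
  {within W, continuous p} /\
  exists q : T' -> T,
    [/\ {within V, continuous q},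
        set_fun W V p /\ set_fun V W q,
        (forall x, W x -> q (p x) = x) &
        (forall y, V y -> p (q y) = y)].

End CoveringMaps.

(* [p : X -> Y] is a covering map: it is continuous and onto, and every point of
   [Y] has an evenly covered neighbourhood.  Continuity and homeomorphisms refer
   to the subspace topologies of [T] and [T'].  Each sheet lies in one of the
   [leaves] and is open in it: [leaves = [set X]] gives the textbook definition,
   whereas if [X] is the disjoint union of the leaves, [p] is, besides being
   continuous on [X], a textbook covering map for the disjoint union topology.
   The second form is the one needed for [normal_projections S], the disjoint
   union of the sets [normal_projections_part S M]: in the norm topology the
   fibres of the map [r] are homeomorphic to the metric space of the regular
   complements [M], which is connected and in general not reduced to a point,
   so that sheets cannot be open in [normal_projections S] itself. *)
Definition covering_map {T T' : topologicalType} (X : set T)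
    (leaves : set (set T)) (Y : set T') (p : T -> T') : Prop :=
  [/\ {within X, continuous p},
      p @` X = Y &
      forall y, Y y -> exists V : set T',
        [/\ V y, relatively_open Y V &
            exists (I : Type) (W : I -> set T),
              [/\ forall i, exists2 L, leaves L & relatively_open L (W i),
                  trivIset setT W,
                  X `&` p @^-1` V = \bigcup_i W i &
                  forall i, homeomorphism_on (W i) V p]]].

(** * Krein space geometry *)

Section Krein.
Context {R : realType} {H : completeNormedModType R[i]}.
Variable ip : {dot H for conjC}.
Implicit Types (A M N S : set H) (T E P Q : 'L(H)).

Definition is_closed_subspace A : Prop :=
  [/\ closed A, A 0 & forall (c : R[i]) x y, A x -> A y -> A (c *: x + y)].

(* By the Riesz representation theorem the adjoint exists; it is unique. *)
Definition adj T : 'L(H) :=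
  xget 0 [set T' : 'L(H) | forall x y, ip (T x) y = ip x (T' y)].

Definition ortho A : set H := [set f | forall g, A g -> ip f g = 0].

(* The orthogonal projection onto a closed subspace. *)
Definition oproj A : 'L(H) :=
  xget 0 [set P : 'L(H) | [/\ P * P = P, adj P = P & range P = A]].

Variable J : 'L(H).

Definition is_symmetry : Prop := adj J = J /\ J * J = 1.

Definition jform (f g : H) : R[i] := ip (J f) g.

Definition jadj T : 'L(H) := J * adj T * J.

Definition jortho A : set H := [set f | forall g, A g -> jform f g = 0].

Definition isotropic A : set H := A `&` jortho A.

(* [A] is the [J]-orthogonal direct sum of [M] and [N]. *)
Definition jdirect_sum A M N : Prop :=
  [/\ A = [set x | exists m n, [/\ M m, N n & x = m + n]],
      M `&` N = [set 0] &
      forall m n, M m -> N n -> jform m n = 0].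

Definition regular M : Prop :=
  is_closed_subspace M /\ jdirect_sum setT M (jortho M).

Definition pseudo_regular S : Prop :=
  is_closed_subspace S /\
  exists M, regular M /\ jdirect_sum S (isotropic S) M.

(* The [J]-selfadjoint projection onto a regular subspace. *)
Definition jproj M : 'L(H) :=
  xget 0 [set E : 'L(H) | [/\ E * E = E, jadj E = E & range E = M]].

Definition normal_projections S : set 'L(H) :=
  [set Q | [/\ Q * Q = Q, Q * jadj Q = jadj Q * Q & range Q = S]].

Definition regular_complements S : set (set H) :=
  [set M | regular M /\ jdirect_sum S M (isotropic S)].

Definition normal_projections_part S M : set 'L(H) :=
  [set Q | normal_projections S Q /\ range (Q * jadj Q) = M].

(** ** The selection [g] *)

(* An operator between two of the summands of
     [H = S^o + (S - S^o) + S^perp]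
   is identified with the operator on [H] which extends it by [0] on the other
   two summands; blocks then multiply and take adjoints inside ['L(H)], and an
   operator matrix is the sum of its blocks. *)
Section Selection.
Variable S : set H.

Let P1 : 'L(H) := oproj (isotropic S).
Let P2 : 'L(H) := oproj (S `&` ortho (isotropic S)).
Let P3 : 'L(H) := oproj (ortho S).

Definition block_a : 'L(H) := P1 * J * P3.
Definition block_b : 'L(H) := P2 * J * P2.
Definition block_c : 'L(H) := P2 * J * P3.

(* The inverse of [b] in the bounded operators on the middle summand. *)
Definition block_binv : 'L(H) :=
  xget 0 [set B : 'L(H) |
    [/\ P2 * B * P2 = B, B * block_b = P2 & block_b * B = P2]].

Definition rho M : 'L(H) := P2 * jproj M * oproj (J @` isotropic S).

Definition selection M : 'L(H) :=
  let a := block_a in let b := block_b in let c := block_c in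
  let r := rho M in
  P1 + P2
  + (- (2^-1 *: (a * adj r * b ^+ 3 * r * adj a * a))
     + a * adj r * (c + b * r))
  + (block_binv * c + r).

End Selection.

(** ** The section [s] *)

Definition partE Q : 'L(H) := Q * jadj Q.
Definition partP Q : 'L(H) := Q * (1 - jadj Q).
Definition partF Q : 'L(H) := (1 - Q) * jadj (1 - Q).

(* The projection of the direct sum [M + N] onto [M] along [N]; only its values
   on [M + N] are meaningful. *)
Definition proj_along M N (x : H) : H :=
  xget 0 [set m | M m /\ N (x - m)].

(* [V(Q)]; only its values on the range of [P0 + P0^#] are meaningful. *)
Definition section_V S Q0 Q (x : H) : H :=
  xget 0 [set y | exists f h,
    [/\ isotropic S f, isotropic S h,
        x = f + jadj (partP Q0) (J h) &
        y = f + jadj (partP Q) (J h)]].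

Definition cross_section S Q0 Q : 'L(H) :=
  xget 0 [set U : 'L(H) | forall x,
    U x = proj_along (range (partE Q)) (isotropic S) (partE Q0 x)
        + proj_along (range (partF Q)) (isotropic S) (partF Q0 x)
        + section_V S Q0 Q ((partP Q0 + jadj (partP Q0)) x)].

End Krein.

(* Main.v *)
Require Import Defs.
From HB Require Import structures.
From mathcomp Require Import all_boot all_order all_algebra.
From mathcomp Require Import all_classical all_reals all_analysis.
From mathcomp Require Import sesquilinear complex.

Set Implicit Arguments.
Unset Strict Implicit.
Unset Printing Implicit Defensive.

Import Order.TTheory GRing.Theory Num.Def Num.Theory.
Import numFieldNormedType.Exports.

Local Open Scope classical_set_scope.
Local Open Scope complex_scope.
Local Open Scope ring_scope.

(** Why the theorem holds.  Write T^# for the J-adjoint of T.  On each set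
    Q_{S,M} the map r is Q |-> U^# Q U for a single J-unitary operator
    U = s(g(M)).  Since U Q0 U^# = g(M), and both Q0 and g(M) have range S while
    Q0 Q0^# and g(M) g(M)^# have ranges M0 and M, conjugation by U carries the
    idempotents with range S to idempotents with range S and exchanges the two
    conditions on R(Q Q^#).  So it is a homeomorphism of Q_{S,M0} onto Q_{S,M},
    with inverse the restriction of r: the whole of Q_{S,M0} is evenly
    covered and the sheets are the sets Q_{S,M} themselves.  The remaining point
    is that r is continuous on all of Q_S, across different M; for this g and s
    are rewritten as polynomials in Q and its adjoint.

    The section.  For a normal idempotent Q, the operators E = Q Q^#,
    P = Q (1 - Q^#), P^# and F = (1 - Q) (1 - Q)^# are orthogonal idempotents
    with sum 1.  Evaluating the projections along S^o and the operator V(Q) in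
    the definition of s gives
      s(Q) = E E0 + F F0 + P P0 + P^# P0^#
    (lemma cross_sectionE).  That this is J-unitary and carries Q0 to Q follows
    from the relations Q Q0 = Q0 and Q0 Q = Q, which say that Q and Q0 have the
    same range; it is a computation in any ring with involution
    (intertwiner_inv, intertwiner_comm).

    The selection.  If E is the J-selfadjoint projection onto M, the block
    formula for g(M) becomes E + P, where P = p1 (1 - E) + x, p1 is the
    orthogonal projection onto S^o and x maps S^perp into S^o.  Since P E, E P
    and P^# P vanish, g(M) is normal with g(M) g(M)^# = E as soon as
    P P^# = 0; the cubic term of x is what makes this happen
    (selection_spec, selection_in_part).  Here E = Q Q^# for any Q in
    Q_{S,M}, so the formula also shows that g(M) depends continuously on Q
    (continuous_selection).

    The Hilbert space theory underneath is the projection onto a closed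
    subspace, the existence of adjoints and the continuity of products and
    adjoints for the operator norm. *)

(** * The inner product and the closest point of a closed subspace *)

Section InnerProduct.
Context {R : realType} {H : completeNormedModType R[i]}.
Variable ip : {dot H for conjC}.
Hypothesis ip_norm : forall x : H, ip x x = `|x| ^+ 2.
Implicit Types (x y z : H) (A : set H).

Lemma ipC x y : ip x y = (ip y x)^*.
Proof. by have := hermC ip x y; rewrite expr0 mul1r. Qed.

Lemma ip0l y : ip 0 y = 0. Proof. exact: linear0l. Qed.
Lemma ip0r x : ip x 0 = 0. Proof. exact: linear0r. Qed.
Lemma ipDl x y z : ip (x + y) z = ip x z + ip y z. Proof. exact: linearDl. Qed.
Lemma ipDr x y z : ip x (y + z) = ip x y + ip x z. Proof. exact: linearDr. Qed.
Lemma ipBl x y z : ip (x - y) z = ip x z - ip y z. Proof. exact: linearBl. Qed.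
Lemma ipBr x y z : ip x (y - z) = ip x y - ip x z. Proof. exact: linearBr. Qed.
Lemma ipZl c x y : ip (c *: x) y = c * ip x y. Proof. exact: linearZl_LR. Qed.
Lemma ipZr c x y : ip x (c *: y) = c^* * ip x y. Proof. exact: linearZr_LR. Qed.

Lemma ip_eq0 x : ip x x = 0 -> x = 0.
Proof. by move/eqP; rewrite ip_norm expf_eq0/= normr_eq0 => /eqP. Qed.

(** Subtracting from x its component along y; both the Cauchy-Schwarz inequality
    and the orthogonality of a minimizer come from this identity. *)
Lemma norm_sub_proj_line x y : y != 0 ->
  `|x - (ip x y / ip y y) *: y| ^+ 2 = `|x| ^+ 2 - `|ip x y| ^+ 2 / `|y| ^+ 2.
Proof.
move=> y0; set c := _ / _.
have yy0 : ip y y != 0 by rewrite ip_norm expf_eq0/= normr_eq0.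
have o : ip (x - c *: y) y = 0.
  by rewrite ipBl ipZl /c divfK ?subrr.
rewrite -ip_norm ipBr ipZr o mulr0 subr0 ipBl ipZl.
by rewrite (ipC y) /c mulrAC -normCK !ip_norm.
Qed.

Lemma cauchy_schwarz x y : `|ip x y| <= `|x| * `|y|.
Proof.
have [->|y0] := eqVneq y 0; first by rewrite ip0r !normr0 mulr0.
rewrite -(@ler_pXn2r _ 2)// ?nnegrE ?mulr_ge0// exprMn.
have y2 : 0 < `|y| ^+ 2 by rewrite exprn_gt0 ?normr_gt0.
by rewrite -ler_pdivrMr// -subr_ge0 -norm_sub_proj_line// exprn_ge0.
Qed.

Lemma ip_continuousl y : continuous (fun x => ip x y).
Proof.
move=> x; apply/cvgrPdist_le => e e0.
have y1 : 0 < `|y| + 1 by rewrite ltr_wpDl.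
near=> t; rewrite -ipBl (le_trans (cauchy_schwarz _ _))//.
apply: (@le_trans _ _ (`|x - t| * (`|y| + 1))).
  by rewrite ler_wpM2l// lerDl.
rewrite -ler_pdivlMr//; near: t.
by apply: cvgr_dist_le; [exact: cvg_id | exact: divr_gt0].
Unshelve. all: by end_near. Qed.

Lemma parallelogram x y :
  `|x + y| ^+ 2 + `|x - y| ^+ 2 = 2 * `|x| ^+ 2 + 2 * `|y| ^+ 2.
Proof.
rewrite -!ip_norm (hnormD ip) (hnormB ip)/= addrACA subrr addr0.
by rewrite !mulr_natl !mulr2n addrACA.
Qed.

Lemma pythagoras x y : ip x y = 0 -> `|x + y| ^+ 2 = `|x| ^+ 2 + `|y| ^+ 2.
Proof. by move=> xy; rewrite -!ip_norm; exact: hnormDd. Qed.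

Lemma closed_subspaceB A x y : is_closed_subspace A -> A x -> A y -> A (x - y).
Proof. by case=> _ _ h Ax Ay; rewrite addrC -scaleN1r; exact: h. Qed.

Lemma closed_subspaceD A x y : is_closed_subspace A -> A x -> A y -> A (x + y).
Proof. by case=> _ _ h Ax Ay; rewrite -[x]scale1r; exact: h. Qed.

Lemma closed_subspaceZ A (c : R[i]) x :
  is_closed_subspace A -> A x -> A (c *: x).
Proof. by case=> _ A0 h Ax; rewrite -[_ *: _]addr0; exact: h. Qed.

Lemma minimizing_sequence A x : A !=set0 ->
  exists (d : R[i]) (a : nat -> H), [/\ forall y, A y -> d <= `|x - y| ^+ 2,
    forall n, A (a n) & forall n, `|x - a n| ^+ 2 <= d + n.+1%:R^-1].
Proof.
case=> y0 Ay0; pose s : set R := [set complex.Re (`|x - y| ^+ 2) | y in A].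
have sC y : (complex.Re (`|x - y| ^+ 2))%:C = `|x - y| ^+ 2.
  by rewrite RRe_real// ger0_real// exprn_ge0.
have s_inf : has_inf s.
  split; first by exists (complex.Re (`|x - y0| ^+ 2)), y0.
  by exists 0 => _ [y Ay <-]; rewrite -lecR sC exprn_ge0.
have /choice[a ha] : forall n, exists y,
    A y /\ complex.Re (`|x - y| ^+ 2) < inf s + n.+1%:R^-1.
  move=> n; have n0 : 0 < n.+1%:R^-1 :> R by rewrite invr_gt0.
  by have [_ [y Ay <-]] := inf_adherent n0 s_inf; exists y.
exists (inf s)%:C, a; split => [y Ay|n|n].
- by rewrite -sC lecR; apply: ge_inf; [case: s_inf | exists y].
- by case: (ha n).
- have [_] := ha n; rewrite -sC -ltcR => /ltW.
  by rewrite rmorphD/= fmorphV/= rmorph_nat.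
Qed.

(** R[i] is not archimedean in the sense of the order hierarchy, its order being
    partial, so the limit of 1/(n+1) is transported from R. *)
Lemma harmonic_lt (e : R[i]) : 0 < e ->
  exists N, forall n, (N <= n)%N -> n.+1%:R^-1 < e.
Proof.
rewrite ltcE/= => /andP[/eqP e_im e_re].
have -> : e = (complex.Re e)%:C by case: e e_im e_re => a b /= ->.
have /cvgr0Pnorm_lt/(_ _ e_re)[N _ hN] := @cvg_harmonic R.
exists N => n Nn; have := hN n Nn; rewrite ger0_norm ?invr_ge0//.
by rewrite -ltcR fmorphV/= rmorph_nat.
Qed.

(** A minimizing sequence for the distance from x to A is Cauchy by the
    parallelogram identity, because midpoints stay in A.  Orthogonality is read
    off along the sequence: moving a_n along z decreases the squared distance by
    |<x - a_n, z>|^2 / |z|^2, which cannot exceed the defect 1/(n+1). *)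
Theorem closest_point A x : is_closed_subspace A ->
  exists2 y, A y & forall z, A z -> ip (x - y) z = 0.
Proof.
move=> cA; have [clA A0 _] := cA.
have [d [a [dle Aa ale]]] := minimizing_sequence x (ex_intro _ 0 A0).
have a_cauchy n m : (n <= m)%N -> `|a n - a m| ^+ 2 <= 4 / n.+1%:R.
  move=> nm.
  have := parallelogram (x - a n) (x - a m).
  have -> : x - a n - (x - a m) = - (a n - a m).
    by rewrite !opprB addrC addrA subrK.
  rewrite normrN.
  have -> : x - a n + (x - a m) = 2 *: (x - 2^-1 *: (a n + a m)).
    rewrite scalerBr scalerA divff ?pnatr_eq0// scale1r scaler_nat mulr2n.
    by rewrite opprD addrACA.
  rewrite normrZ exprMn ger0_norm// => e.
  have le : d <= `|x - 2^-1 *: (a n + a m)| ^+ 2.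
    by apply: dle; apply: closed_subspaceZ => //; apply: closed_subspaceD.
  have -> : `|a n - a m| ^+ 2 = 2 * `|x - a n| ^+ 2 + 2 * `|x - a m| ^+ 2 -
      2 ^+ 2 * `|x - 2^-1 *: (a n + a m)| ^+ 2.
    by rewrite -e addrAC subrr add0r.
  rewrite lerBlDr.
  have -> : 4 / n.+1%:R + 2 ^+ 2 * `|x - 2^-1 *: (a n + a m)| ^+ 2 =
     2 * (`|x - 2^-1 *: (a n + a m)| ^+ 2 + n.+1%:R^-1) +
     2 * (`|x - 2^-1 *: (a n + a m)| ^+ 2 + n.+1%:R^-1) :> R[i].
    rewrite -mulrDr -mulr2n -(mulr_natl (_ + _)) mulrA mulrDr addrC.
    by rewrite -natrX -natrM.
  apply: lerD; rewrite ler_pM2l// (le_trans (ale _))// lerD//.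
  by rewrite lef_pV2 ?posrE// ler_nat.
have /cauchy_cvgP/cvg_ex[y ay] : cauchy (a @ \oo).
  apply: cauchy_exP => e e0.
  have /harmonic_lt[N hN] : 0 < e ^+ 2 / 4 by rewrite divr_gt0// exprn_gt0.
  exists (a N); exists N => // m /= Nm.
  rewrite -ball_normE/= -(@ltr_pXn2r _ 2)// ?nnegrE ?(ltW e0)//.
  apply: le_lt_trans (a_cauchy _ _ Nm) _.
  by rewrite mulrC -ltr_pdivlMr//; exact: hN.
exists y; first by apply: (@closed_cvg _ _ _ _ a A clA _ y ay); exact: nearW.
move=> z Az; have [->|z0] := eqVneq z 0; first exact: ip0r.
have ipa : (fun n => ip (x - a n) z) @ \oo --> ip (x - y) z.
  apply: (@cvg_comp _ _ _ (fun n => x - a n) (ip ^~ z) \oo (nbhs (x - y)));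
    last exact: ip_continuousl.
  by apply: cvgB => //; exact: cvg_cst.
suff ipa0 : (fun n => ip (x - a n) z) @ \oo --> (0 : R[i]^o).
  exact: (@norm_cvg_unique _ R[i]^o _ _ _ _ ipa ipa0).
have z2 : 0 < `|z| ^+ 2 by rewrite exprn_gt0 ?normr_gt0.
apply/cvgr0Pnorm_lt => e e0.
have /harmonic_lt[N hN] : 0 < e ^+ 2 / `|z| ^+ 2.
  by rewrite divr_gt0// exprn_gt0.
exists N => // n /= /hN; rewrite ltr_pdivlMr// => ne.
rewrite -(@ltr_pXn2r _ 2)// ?nnegrE ?(ltW e0)//.
apply: le_lt_trans ne; rewrite -ler_pdivrMr//.
have := dle _ (closed_subspaceD cA (Aa n)
  (closed_subspaceZ (ip (x - a n) z / ip z z) cA Az)).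
rewrite opprD addrA norm_sub_proj_line// => dl.
have := le_trans dl (lerB (ale n) (lexx _)).
by rewrite -addrA lerDl subr_ge0.
Unshelve. all: by end_near. Qed.
End InnerProduct.

(** * Normal idempotents in a ring with involution *)

Record ring_involution (A : pzRingType) (star : A -> A) : Prop :=
  RingInvolution {
  involutionD : forall x y, star (x + y) = star x + star y ;
  involutionM : forall x y, star (x * y) = star y * star x ;
  involutionK : involutive star }.

Section StarRing.
Variables (A : pzRingType) (star : A -> A).
Hypothesis star_inv : ring_involution star.
Implicit Types p q : A.

Let starD x y : star (x + y) = star x + star y.
Proof. exact: involutionD. Qed.
Let starM x y : star (x * y) = star y * star x.
Proof. exact: involutionM. Qed.
Let starK : involutive star. Proof. exact: involutionK. Qed.

Let star0 : star 0 = 0.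
Proof. by apply: (addrI (star 0)); rewrite -starD !addr0. Qed.
Let starN x : star (- x) = - star x.
Proof. by apply: (addrI (star x)); rewrite -starD !subrr star0. Qed.
Let star1 : star 1 = 1.
Proof. by rewrite -[LHS]mulr1 -{2}[1]starK -starM mulr1 starK. Qed.

Definition normal_idem p := p * p = p /\ p * star p = star p * p.
(** The parts of a normal idempotent p.  When p is a projection with range S and
    star is the J-adjoint, [selfadj_part p] and [coselfadj_part p] project onto
    regular complements of the isotropic part of S in S and in its J-orthogonal
    complement, while [isotropic_part p] projects onto the isotropic part. *)
Definition selfadj_part p := p * star p.
Definition isotropic_part p := p * (1 - star p).
Definition coselfadj_part p := (1 - p) * star (1 - p).

Lemma starB1 p : star (1 - p) = 1 - star p.
Proof. by rewrite starD starN star1. Qed.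

Lemma idem_star p : p * p = p -> star p * star p = star p.
Proof. by move=> pp; rewrite -starM pp. Qed.

Lemma idem_compl p : p * p = p -> (1 - p) * (1 - p) = 1 - p.
Proof. by move=> pp; rewrite mulrBl mul1r mulrBr mulr1 pp subrr subr0. Qed.

Lemma idem_compl0 p : p * p = p -> p * (1 - p) = 0.
Proof. by move=> pp; rewrite mulrBr mulr1 pp subrr. Qed.

Lemma compl_idem0 p : p * p = p -> (1 - p) * p = 0.
Proof. by move=> pp; rewrite mulrBl mul1r pp subrr. Qed.

Lemma comm_compl p q : p * q = q * p -> p * (1 - q) = (1 - q) * p.
Proof. by move=> pq; rewrite mulrBr mulrBl mulr1 mul1r pq. Qed.

Lemma mulrACA_comm (a b c d : A) :
  b * c = c * b -> a * b * (c * d) = a * c * (b * d).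
Proof. by move=> bc; rewrite !mulrA -(mulrA a b) bc mulrA. Qed.

Definition orthogonal_idems (f1 f2 f3 f4 : A) :=
  [/\ [/\ f1 * f1 = f1, f1 * f2 = 0, f1 * f3 = 0 & f1 * f4 = 0],
      [/\ f2 * f1 = 0, f2 * f2 = f2, f2 * f3 = 0 & f2 * f4 = 0],
      [/\ f3 * f1 = 0, f3 * f2 = 0, f3 * f3 = f3 & f3 * f4 = 0]
    & [/\ f4 * f1 = 0, f4 * f2 = 0, f4 * f3 = 0 & f4 * f4 = f4]].

(** Each part is a product of one of p, 1 - p with one of p*, 1 - p*, and these
    four idempotents commute. *)
Lemma normal_idem_parts p : normal_idem p ->
  orthogonal_idems (selfadj_part p) (isotropic_part p)
    (star (isotropic_part p)) (coselfadj_part p).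
Proof.
case=> pp pC; have qq := idem_star pp; move: pC qq.
rewrite /selfadj_part /isotropic_part /coselfadj_part starM !starB1 starK.
move: (star p) => q pC qq.
have pqC' := comm_compl pC; have qpC' := comm_compl (esym pC).
have p'q'C := comm_compl (esym qpC').
have t := (idem_compl pp, idem_compl qq, idem_compl0 pp, idem_compl0 qq,
  compl_idem0 pp, compl_idem0 qq, pp, qq).
by split; split; rewrite mulrACA_comm ?t ?mulr0 ?mul0r //; congruence.
Qed.

Lemma star_selfadj_part p : star (selfadj_part p) = selfadj_part p.
Proof. by rewrite /selfadj_part starM starK. Qed.

Lemma star_coselfadj_part p : star (coselfadj_part p) = coselfadj_part p.
Proof. by rewrite /coselfadj_part starM starK. Qed.

Lemma selfadj_add_isotropic p : selfadj_part p + isotropic_part p = p.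
Proof. by rewrite /selfadj_part /isotropic_part mulrBr mulr1 addrC subrK. Qed.

Lemma parts_sum1 p : normal_idem p ->
  selfadj_part p + coselfadj_part p + isotropic_part p
  + star (isotropic_part p) = 1.
Proof.
case=> pp pC; rewrite (addrAC (selfadj_part p)) selfadj_add_isotropic -addrA.
rewrite /coselfadj_part /isotropic_part starM !starB1 starK.
by rewrite -mulrDr subrK mulr1 addrC subrK.
Qed.

(** The sum of the maps that send each part of r to the same part of p. *)
Definition intertwiner p r :=
  selfadj_part p * selfadj_part r + coselfadj_part p * coselfadj_part r
  + isotropic_part p * isotropic_part r
  + star (isotropic_part p) * star (isotropic_part r).

Lemma star_intertwiner p r : star (intertwiner p r) = intertwiner r p.
Proof.
rewrite /intertwiner !starD (starM (selfadj_part p)).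
rewrite (starM (coselfadj_part p)) (starM (isotropic_part p)).
rewrite (starM (star (isotropic_part p))) !starK.
rewrite !star_coselfadj_part !star_selfadj_part.
by rewrite addrAC.
Qed.

(** The hypotheses [p * r = r] and [r * p = p] say that p and r have the same
    range.  Applying the involution, p* and r* have the same kernel.  The part E
    is a product of p and p* in either order, so the two facts can be used on
    both sides of the middle factor; F is the same with the complements. *)
Section SameRange.
Variables p r : A.
Hypotheses (p_n : normal_idem p) (r_n : normal_idem r).
Hypotheses (pr : p * r = r) (rp : r * p = p).

Lemma selfadj_part_sandwich :
  selfadj_part p * selfadj_part r * selfadj_part p = selfadj_part p.
Proof.
have [[pp pC] [rr rC]] := (p_n, r_n).
have sps : star p * star r = star p by rewrite -starM rp.
have srs : star r * star p = star r by rewrite -starM pr.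
have -> : selfadj_part p = star p * p by exact: pC.
rewrite /selfadj_part -!mulrA (mulrA p r) pr (mulrA (star r)) srs.
by rewrite (mulrA r) rC -mulrA rp mulrA sps.
Qed.

Lemma coselfadj_part_sandwich :
  coselfadj_part p * coselfadj_part r * coselfadj_part p = coselfadj_part p.
Proof.
have [[pp pC] [rr rC]] := (p_n, r_n).
have p'r' : (1 - p) * (1 - r) = 1 - p.
  by rewrite mulrBl mul1r mulrBr mulr1 pr opprB addrA subrK.
have sr'p' : star (1 - r) * star (1 - p) = star (1 - p) by rewrite -starM p'r'.
have FE : coselfadj_part p = star (1 - p) * (1 - p).
  rewrite /coselfadj_part starB1; apply: comm_compl; symmetry; exact: comm_compl.
rewrite [in LHS]FE /coselfadj_part -!mulrA (mulrA (1 - p) (1 - r)) p'r'.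
rewrite (mulrA (star (1 - r))) sr'p' mulrA -FE.
by have [_ _ _ [_ _ _ FF]] := normal_idem_parts p_n; exact: FF.
Qed.

Lemma isotropic_part_mul : isotropic_part p * isotropic_part r = isotropic_part r.
Proof.
have [[pp pC] [rr rC]] := (p_n, r_n).
have qs : (1 - star p) * (1 - star r) = 1 - star r.
  by rewrite mulrBl mul1r mulrBr mulr1 -starM rp subrr subr0.
rewrite /isotropic_part (comm_compl pC) -mulrA (mulrA p) pr (comm_compl rC).
by rewrite mulrA qs.
Qed.
End SameRange.

Lemma orthogonal_idems_mul (e1 e2 e3 e4 f1 f2 f3 f4 : A) :
  orthogonal_idems f1 f2 f3 f4 ->
  (e1 * f1 + e4 * f4 + e2 * f2 + e3 * f3) *
    (f1 * e1 + f4 * e4 + f2 * e2 + f3 * e3) =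
  e1 * f1 * e1 + e4 * f4 * e4 + e2 * f2 * e2 + e3 * f3 * e3.
Proof.
have mid (a b c d : A) : a * b * (c * d) = a * (b * c) * d by rewrite !mulrA.
move=> [[f11 f12 f13 f14] [f21 f22 f23 f24]
  [f31 f32 f33 f34] [f41 f42 f43 f44]].
rewrite !mulrDl !mulrDr !mid f11 f12 f13 f14 f21 f22 f23 f24 f31 f32 f33 f34.
by rewrite f41 f42 f43 f44 !mulr0 !mul0r !addr0 !add0r.
Qed.

Lemma orthogonal_idems_commute (e1 e2 e3 e4 f1 f2 f3 f4 : A) :
  orthogonal_idems e1 e2 e3 e4 -> orthogonal_idems f1 f2 f3 f4 ->
  (e1 * f1 + e4 * f4 + e2 * f2 + e3 * f3) * (f1 + f2) =
  (e1 + e2) * (e1 * f1 + e4 * f4 + e2 * f2 + e3 * f3).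
Proof.
move=> [[e11 e12 e13 e14] [e21 e22 e23 e24] _ _].
move=> [[f11 f12 _ _] [f21 f22 _ _] [f31 f32 _ _] [f41 f42 _ _]].
rewrite [LHS]mulrDr !mulrDl -!mulrA f11 f12 f21 f22 f31 f32 f41 f42.
rewrite !mulrDr !mulrA e11 e12 e13 e14 e21 e22 e23 e24.
by rewrite !mulr0 !mul0r !addr0 !add0r.
Qed.

Lemma intertwiner_inv p r : normal_idem p -> normal_idem r ->
  p * r = r -> r * p = p -> intertwiner p r * intertwiner r p = 1.
Proof.
move=> pn rn pr rp.
rewrite /intertwiner (orthogonal_idems_mul _ _ _ _ (normal_idem_parts rn)).
rewrite selfadj_part_sandwich// coselfadj_part_sandwich//.
rewrite isotropic_part_mul// isotropic_part_mul// -starM.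
rewrite isotropic_part_mul// -starM.
by rewrite isotropic_part_mul ?parts_sum1//; case: pn.
Qed.

Lemma intertwiner_comm p r : normal_idem p -> normal_idem r ->
  intertwiner p r * r = p * intertwiner p r.
Proof.
move=> pn rn.
have := orthogonal_idems_commute (normal_idem_parts pn) (normal_idem_parts rn).
by rewrite -/(intertwiner p r) !selfadj_add_isotropic.
Qed.

(** * The selected idempotent in a ring with involution *)

Lemma null_block_congruence (J k t t' c c' : A) : J * J = 1 ->
  t * J * t' = 0 -> t * c' = 0 -> c * t' = 0 ->
  (k * (t * J) + c) * J * (J * t' * k + c') = c * J * c'.
Proof.
move=> JJ tJt tc ct.
have ktJJ : k * (t * J) * J = k * t by rewrite -!mulrA JJ mulr1.
rewrite mulrDl ktJJ mulrDl !mulrDr -(mulrA k t c') tc mulr0 addr0.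
rewrite !mulrA -(mulrA k t J) -(mulrA k) tJt mulr0 mul0r add0r.
by rewrite -(mulrA c J J) JJ mulr1 ct mul0r add0r.
Qed.

Lemma corner_inverse_uniq (p b B B' : A) : p * p = p ->
  p * B * p = B -> B * b = p -> p * B' * p = B' -> b * B' = p -> B = B'.
Proof.
move=> pp Bm Bl Bm' Br'.
have <- : B * p = B by rewrite -Bm -mulrA pp.
by rewrite -Br' mulrA Bl -Bm' !mulrA pp.
Qed.

(** Here J is the fundamental symmetry, p1 and p2 are the orthogonal projections
    onto S^o and S - S^o, and E is the J-selfadjoint projection onto a regular
    complement M of S^o in S.  [J11] and [J12] say that S^o is J-orthogonal to S;
    [pE], [E1] and [E2] say that E maps into S, kills S^o, and that S is M plus
    S^o.  The operators a, b, c, r are the blocks of the selection, r being rho,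
    and T = rho a* with adjoint T'. *)
Section Selection.
Variables J p1 p2 E : A.
Hypotheses (JJ : J * J = 1) (starJ : star J = J).
Hypotheses (p11 : p1 * p1 = p1) (p22 : p2 * p2 = p2).
Hypotheses (p12 : p1 * p2 = 0) (p21 : p2 * p1 = 0).
Hypotheses (p1s : star p1 = p1) (p2s : star p2 = p2).
Hypotheses (J11 : p1 * J * p1 = 0) (J12 : p1 * J * p2 = 0).
Hypotheses (EE : E * E = E) (Es : J * star E * J = E).
Hypotheses (pE : (p1 + p2) * E = E) (E1 : E * p1 = 0) (E2 : p2 * E * p2 = p2).

Local Notation p3 := (1 - (p1 + p2)).
Local Notation a := (p1 * J * p3).
Local Notation b := (p2 * J * p2).
Local Notation c := (p2 * J * p3).
Local Notation binv := (p2 * E * J * p2).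
Local Notation r := (p2 * E * (J * p1 * J)).
Let T := p2 * E * J * p1.
Let T' := p1 * E * J * p2.

Let J21 : p2 * J * p1 = 0.
Proof.
by have := congr1 star J12; rewrite !starM starJ p1s p2s mulrA star0.
Qed.

Let EJ : E * J = J * star E.
Proof. by rewrite -[E in LHS]Es -!mulrA JJ mulr1. Qed.

Let JE : J * E = star E * J.
Proof. by rewrite -[E in LHS]Es !mulrA JJ mul1r. Qed.

Let p3s : star p3 = p3.
Proof. by rewrite starB1 starD p1s p2s. Qed.

Let p13 : p1 * p3 = 0.
Proof. by rewrite mulrBr mulr1 mulrDr p11 p12 addr0 subrr. Qed.

Let p31 : p3 * p1 = 0.
Proof. by rewrite mulrBl mul1r mulrDl p11 p21 addr0 subrr. Qed.

Let p32 : p3 * p2 = 0.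
Proof. by rewrite mulrBl mul1r mulrDl p22 p12 add0r subrr. Qed.

Let p3E : p3 * E = 0.
Proof. by rewrite mulrBl mul1r pE subrr. Qed.

Let Esp3 : star E * p3 = 0.
Proof. by rewrite -p3s -starM p3E star0. Qed.

Let p1Es : p1 * star E = 0.
Proof. by rewrite -p1s -starM E1 star0. Qed.

Let EJp3 : E * J * p3 = 0.
Proof. by rewrite EJ -mulrA Esp3 mulr0. Qed.

Let EJp : E * J * (p1 + p2) = E * J.
Proof. by apply/esym/eqP; rewrite -subr_eq0 -{1}[E * J]mulr1 -mulrBr EJp3. Qed.

Let aE : a = p1 * J.
Proof. by rewrite mulrBr mulr1 mulrDr J11 J12 addr0 subr0. Qed.

Let star_a : star a = J * p1.
Proof. by rewrite aE starM starJ p1s. Qed.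

Let starT : star T = T'.
Proof. by rewrite /T !starM starJ p1s p2s !mulrA -(mulrA p1) -EJ mulrA. Qed.

Let rE : r = T * J.
Proof. by rewrite /T !mulrA. Qed.

Let star_r : star r = J * T'.
Proof. by rewrite rE starM starT starJ. Qed.

Lemma row_star_rho : a * star r = p1 * E * J * p2.
Proof. by rewrite aE star_r mulrA -(mulrA p1) JJ mulr1 /T' !mulrA p11. Qed.

Lemma rho_star_row : r * star a * a = r.
Proof.
rewrite star_a aE !mulrA -(mulrA _ J J) JJ mulr1 -(mulrA _ p1 p1) p11.
by rewrite -(mulrA _ p1 p1) p11.
Qed.

Let p2JE : p2 * J * E = b * E.
Proof. by rewrite -[in LHS]pE mulrA mulrDr J21 add0r. Qed.

(** The middle block b = p2 J p2 is invertible with inverse p2 E J p2: since E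
    maps into S and S is J-orthogonal to S^o, b E = p2 J E = p2 E* J, and E*
    compresses to the identity on the middle block. *)
Lemma binv_right : b * binv = p2.
Proof.
have -> : b * binv = p2 * J * p2 * E * J * p2.
  by rewrite !mulrA -(mulrA _ p2 p2) p22.
rewrite -p2JE -!mulrA (mulrA E) EJ !mulrA -(mulrA p2) JJ mulr1.
by have := congr1 star E2; rewrite !starM p2s mulrA.
Qed.

Lemma star_binv : star binv = binv.
Proof. by rewrite !starM starJ p2s !mulrA -(mulrA p2 J) -EJ !mulrA. Qed.

Lemma binv_left : binv * b = p2.
Proof.
rewrite -star_binv.
have -> : b = star b by rewrite !starM starJ p2s mulrA.
by rewrite -starM binv_right.
Qed.

Lemma binv_mid : p2 * binv * p2 = binv.
Proof. by rewrite !mulrA p22 -mulrA p22. Qed.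

Lemma binv_spec : [/\ p2 * binv * p2 = binv, binv * b = p2 & b * binv = p2].
Proof. by split; [exact: binv_mid | exact: binv_left | exact: binv_right]. Qed.

(** The last column of the selection is the corner of E itself.  Indeed E J
    vanishes on the orthogonal complement of S, so E = E J (p1 + p2) J. *)
Let block23 : binv * c + r = p2 * E * p3.
Proof.
have -> : binv * c = p2 * E * J * p2 * J * p3.
  by rewrite !mulrA -(mulrA _ p2 p2) p22.
have -> : r = p2 * E * J * p1 * J * p3.
  by rewrite -[RHS]mulrA -[RHS]mulrA (mulrA p1) aE !mulrA.
rewrite -!mulrDl -mulrDr addrC -(mulrA p2 E J) -(mulrA p2 _ (p1 + p2)) EJp.
by rewrite !mulrA -(mulrA _ J J) JJ mulr1.
Qed.

(** k plays the role of b - b^3 / 2; only its double is prescribed because the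
    ring has no scalars. *)
Variable k : A.
Hypotheses (ks : star k = k) (k_double : k + k = b + b - b * b * b).

Let x := T' * (k * r + c).
Let P := p1 - p1 * E + x.
Let Q := p1 + p2 + x + (binv * c + r).

Let QE : Q = E + P.
Proof.
have Ep3 : E * p3 = E - E * p2 by rewrite mulrBr mulr1 mulrDr E1 add0r.
have split_E z : E + z = p1 * E + p2 * E + z by rewrite -mulrDl pE.
rewrite /Q block23 /P -mulrA Ep3 mulrBr mulrA E2 split_E.
rewrite (addrAC p1) -(addrA (p1 + x)) (addrCA p2) subrr addr0.
by rewrite (addrAC p1 _ x) [RHS]addrC addrA subrK.
Qed.

Let r12 : r * (p1 + p2) = 0.
Proof.
rewrite !mulrA -(mulrA _ J) -(mulrA _ p1) (mulrA p1) mulrDr.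
by rewrite J11 J12 addr0 mulr0.
Qed.

Let c12 : c * (p1 + p2) = 0.
Proof.
by rewrite -mulrA (mulrDr p3) p31 p32 addr0 mulr0.
Qed.

Let x12 : x * (p1 + p2) = 0.
Proof. by rewrite /x -mulrA mulrDl -mulrA r12 c12 mulr0 addr0 mulr0. Qed.

Let xE : x * E = 0.
Proof. by rewrite -pE mulrA x12 mul0r. Qed.

Let PE : P * E = 0.
Proof. by rewrite /P mulrDl mulrBl xE -mulrA EE subrr addr0. Qed.

Let p1P : p1 * P = P.
Proof.
rewrite /P mulrDr mulrBr mulrA p11; congr (_ + _).
by rewrite /x /T' !mulrA p11.
Qed.

Let EP : E * P = 0.
Proof. by rewrite -p1P mulrA E1 mul0r. Qed.

Let p1J1 z : p1 * J * (p1 * z) = 0.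
Proof. by rewrite mulrA J11 mul0r. Qed.

(** The range of P is in S^o, which is neutral. *)
Let PsJP : star P * J * P = 0.
Proof. by rewrite -p1P starM p1s -!mulrA (mulrA p1 J) p1J1 mulr0. Qed.

Let Tr : T * J * T' = 0.
Proof. by rewrite /T /T' -!mulrA (mulrA p1 J) p1J1 !mulr0. Qed.

Let star_c : star c = p3 * J * p2.
Proof. by rewrite !starM starJ p2s p3s mulrA. Qed.

Let Tc : T * star c = 0.
Proof. by rewrite star_c /T -!mulrA (mulrA p1 p3) p13 mul0r !mulr0. Qed.

Let cT : c * T' = 0.
Proof. by rewrite -[LHS]starK starM -{1}starT starK Tc star0. Qed.

Let p2J3 : c = p2 * J - b.
Proof. by rewrite mulrBr mulr1 mulrDr J21 add0r. Qed.

Let cJc : c * J * star c = b * b * b - b.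
Proof.
have p3J2 : p3 * J * p2 = J * p2 - b.
  by rewrite mulrBl mul1r mulrBl mulrDl mulrDl J12 add0r.
have p2b : p2 * b = b by rewrite !mulrA p22.
have bp2 : b * p2 = b by rewrite -mulrA p22.
have bJb : b * J * b = b * b * b.
  by rewrite !mulrA -!(mulrA _ p2 p2) !p22.
rewrite star_c p2J3 p3J2 mulrBl -(mulrA p2) JJ mulr1 mulrBr !mulrBl.
rewrite p2b bJb (mulrA p2 J) -(mulrA b J) (mulrA J J p2) JJ mul1r bp2.
by rewrite subrr sub0r opprB.
Qed.

Let compressed_E : p1 * E * J * p1 = T' * b * T.
Proof.
have JEJ : J * E * J = star E by rewrite JE -mulrA JJ mulr1.
have EJp2Es : E * J * p2 * star E = E * J.
  have -> : E * J * p2 * star E = E * J * (p1 + p2) * star E.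
    by rewrite mulrDr mulrDl -(mulrA (E * J) p1) p1Es mulr0 add0r.
  by rewrite EJp -mulrA -EJ mulrA EE.
have -> : T' * b * T = p1 * (E * J * p2 * (J * E * J)) * p1.
  rewrite (_ : _ * p1 = p1 * E * J * (p2 * J * E) * J * p1).
    by rewrite p2JE /T' /T !mulrA -!(mulrA _ p2 p2) !p22.
  by rewrite !mulrA.
by rewrite JEJ EJp2Es mulrA.
Qed.

Let star_x : star x = (J * T' * k + star c) * T.
Proof. by rewrite /x starM starD starM ks star_r -{2}starT starK. Qed.

Let xJp1 : x * J * p1 = T' * k * T.
Proof.
have cJp1 : c * (J * p1) = 0.
  rewrite p2J3 mulrBl mulrA -(mulrA p2 J) JJ mulr1 p21.
  by rewrite mulrA -(mulrA (p2 * J) p2 J) -(mulrA (p2 * J)) J21 mulr0 subr0.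
rewrite /x rE -2!mulrA mulrDl cJp1 addr0 -(mulrA k) -(mulrA T) (mulrA J J) JJ.
by rewrite mul1r /T -!mulrA p11.
Qed.

Let xJx : x * J * star x = T' * (b * b * b - b) * T.
Proof.
rewrite star_x /x rE -cJc -(null_block_congruence k JJ Tr Tc cT).
by rewrite !mulrA.
Qed.

(** The first term of P contributes - p1 E J p1 = - T' b T, the two mixed terms
    contribute 2 T' k T and x contributes T' (b^3 - b) T, which add up to
    T' (2 k - 2 b + b^3) T.  This vanishes by the choice of k. *)
Let PJPs : P * J * star P = 0.
Proof.
have Pe : P = p1 * (1 - E) + x by rewrite mulrBr mulr1.
have EJE : (1 - E) * J * star (1 - E) = (1 - E) * J.
  rewrite starB1 mulrBr mulr1 -(mulrA (1 - E)) -EJ mulrA.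
  by rewrite compl_idem0// mul0r subr0.
have x1E : x * (1 - E) = x by rewrite mulrBr mulr1 xE subr0.
have xJe : x * J * star (p1 * (1 - E)) = T' * k * T.
  rewrite starM p1s mulrA -[in LHS]x1E -(mulrA x) -(mulrA x) EJE mulrA x1E.
  exact: xJp1.
have eJx : p1 * (1 - E) * J * star x = T' * k * T.
  have starT' : star T' = T by rewrite -starT starK.
  have := congr1 star xJe; rewrite (starM (x * J)) starK (starM x) starJ mulrA.
  by move=> ->; rewrite (starM (T' * k)) (starM T') ks starT starT' mulrA.
have eJe : p1 * (1 - E) * J * star (p1 * (1 - E)) = - (T' * b * T).
  rewrite starM p1s mulrA -(mulrA p1) -(mulrA p1) EJE -compressed_E mulrBl mul1r.
  by rewrite mulrBr mulrBl J11 sub0r mulrA.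
rewrite Pe starD !mulrDl mulrDr (mulrDr (x * J)) eJe eJx xJe xJx.
rewrite -mulNr -mulrN -!mulrDl -!mulrDr addrA -(addrA (- b)) k_double !addrA.
by rewrite addNr add0r subrK subrr mulr0 mul0r.
Qed.

Lemma selection_left : (p1 + p2) * Q = Q.
Proof.
by rewrite QE mulrDr pE -p1P mulrA (mulrDl p1) p11 p21 addr0.
Qed.

Lemma selection_right : Q * (p1 + p2) = p1 + p2.
Proof.
have Ep : E * (p1 + p2) = p1 * E * p2 + p2.
  by rewrite mulrDr E1 add0r -{1}pE !mulrDl E2.
rewrite QE mulrDl Ep /P mulrDl x12 addr0 mulrBl -(mulrA p1 E (_ + _)) Ep.
rewrite !mulrDr p11 p12 !addr0.
by rewrite !mulrA p11 addrC addrA subrK.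
Qed.

Lemma selection_idem : Q * Q = Q.
Proof. by rewrite -{2}selection_left mulrA selection_right selection_left. Qed.

Lemma selection_star : Q * (J * star Q * J) = E.
Proof.
have EJPs : E * J * star P = 0 by rewrite EJ -mulrA -starM PE star0 mulr0.
rewrite QE starD mulrDr mulrDl Es mulrDr mulrDl EE PE addr0 !mulrA.
by rewrite mulrDl mulrDl EJPs PJPs addr0 mul0r addr0.
Qed.

Lemma star_selection : (J * star Q * J) * Q = E.
Proof.
have PsJE : star P * J * E = 0 by rewrite -mulrA JE mulrA -starM EP star0 mul0r.
have -> : J * star Q * J = E + J * star P * J.
  by rewrite QE starD mulrDr mulrDl Es.
rewrite QE mulrDl (mulrDr E) (mulrDr (J * _ * J)) EE EP -(mulrA J (star P) J).
by rewrite -(mulrA J _ E) -(mulrA J _ P) PsJE PsJP mulr0 !addr0.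
Qed.

Lemma selection_spec : [/\ Q * Q = Q, (p1 + p2) * Q = Q,
  Q * (p1 + p2) = p1 + p2, Q * (J * star Q * J) = E & J * star Q * J * Q = E].
Proof.
by split; [exact: selection_idem | exact: selection_left
  | exact: selection_right | exact: selection_star | exact: star_selection].
Qed.

End Selection.
End StarRing.
(** * Adjoints and orthogonal projections *)

Section Adjoint.
Context {R : realType} {H : completeNormedModType R[i]}.
Variable ip : {dot H for conjC}.
Hypothesis ip_norm : forall x : H, ip x x = `|x| ^+ 2.
Implicit Types (x y z : H) (A : set H) (T U P : 'L(H)).

Lemma ip_right_inj x y : (forall z, ip z x = ip z y) -> x = y.
Proof.
move=> xy; apply/eqP; rewrite -subr_eq0; apply/eqP/(ip_eq0 ip_norm).
by rewrite ipBr xy subrr.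
Qed.

Lemma bop_norm_le T x : `|T x| <= `|T| * `|x|.
Proof.
have [->|x0] := eqVneq x 0; first by rewrite linear0 !normr0 mulr0.
rewrite -ler_pdivrMr ?normr_gt0//.
have -> : `|T x| / `|x| = `|T (`|x|^-1 *: x)|.
  by rewrite linearZ normrZ normfV normr_id mulrC.
by apply: opnorm_ge; rewrite normrZ normfV normr_id mulVf// normr_eq0.
Qed.

Lemma bop_of_bounded (f : H -> H) (M : R[i]) : linear f ->
  (forall x, `|f x| <= M * `|x|) -> exists T : 'L(H), T =1 f.
Proof.
move=> lf fM; suff fP : f \in is_bounded_operator by exists (BoundedOperator fP).
apply/asboolP; split=> // x; apply/cvgrPdist_le => e e0.
have M1 : 0 < `|M| + 1 by rewrite ltr_wpDl.
near=> t; have -> : f x - f t = f (x - t).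
  by rewrite addrC -scaleN1r -lf scaleN1r addrC.
apply: (@le_trans _ _ (`|x - t| * (`|M| + 1))).
  (* M is a nonnegative real as soon as some vector is nonzero. *)
  have M0 : M \is Num.real \/ x - t = 0.
    have [->|xt] := eqVneq (x - t) 0; [by right | left].
    have := le_trans (normr_ge0 _) (fM (x - t)).
    by rewrite pmulr_lge0 ?normr_gt0// => /ger0_real.
  case: M0 => [M_real|->]; last first.
    by have := fM 0; rewrite normr0 mulr0 mul0r.
  rewrite (le_trans (fM _))// mulrC ler_wpM2l//.
  by rewrite (le_trans (real_ler_norm M_real))// lerDl.
rewrite -ler_pdivlMr//; near: t.
by apply: cvgr_dist_le; [exact: cvg_id | exact: divr_gt0].
Unshelve. all: by end_near. Qed.

Theorem orthogonal_projection_exists A : is_closed_subspace A ->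
  exists P : 'L(H), [/\ P * P = P, forall x y, ip (P x) y = ip x (P y) &
    range P = A].
Proof.
move=> cA; have [_ A0 AP] := cA.
have /choice[p hp] : forall x, exists y,
    A y /\ forall z, A z -> ip (x - y) z = 0.
  by move=> x; have [y Ay yP] := closest_point ip_norm x cA; exists y.
have pA x : A (p x) by case: (hp x).
have pO x z : A z -> ip (x - p x) z = 0 by case: (hp x) => _; exact.
have p_uniq x y : A y -> (forall z, A z -> ip (x - y) z = 0) -> p x = y.
  move=> Ay yO; have Ad : A (p x - y) by exact: closed_subspaceB.
  apply/eqP; rewrite -subr_eq0; apply/eqP/(ip_eq0 ip_norm).
  have -> : ip (p x - y) (p x - y) = ip (x - y) (p x - y) - ip (x - p x) (p x - y).
    by rewrite -ipBl; congr (ip _ _); rewrite opprB [RHS]addrC addrA subrK.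
  by rewrite yO// pO// subrr.
have p_lin : linear p.
  move=> c x y; apply: p_uniq; first exact: AP.
  move=> z Az; have -> : c *: x + y - (c *: p x + p y) =
      c *: (x - p x) + (y - p y).
    by rewrite scalerBr opprD addrACA.
  by rewrite ipDl ipZl !pO// mulr0 addr0.
have p_le x : `|p x| <= 1 * `|x|.
  rewrite mul1r -(@ler_pXn2r _ 2)// ?nnegrE//.
  rewrite -[X in _ <= `|X| ^+ 2](subrK (p x)).
  by rewrite (pythagoras ip_norm (pO x _ (pA x))) lerDr exprn_ge0.
have [P PE] := bop_of_bounded p_lin p_le.
exists P; split.
- apply/bop_eqP => x; rewrite bop_mulE !PE; apply: p_uniq => // z _.
  by rewrite subrr ip0l.
- move=> x y; rewrite !PE; transitivity (ip (p x) (p y)); apply/eqP.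
    by rewrite -subr_eq0 -ipBr ipC pO// rmorph0.
  by rewrite eq_sym -subr_eq0 -ipBl pO.
- apply/seteqP; split=> [_ [x _ <-]|x Ax]; first by rewrite PE.
  by exists x => //; rewrite PE; apply: p_uniq => // z _; rewrite subrr ip0l.
Qed.

(** The kernel of f is closed; a vector v orthogonal to it spans a complement, and
    f x is then proportional to <x, v>. *)
Theorem riesz_representation (f : H -> R[i]) (M : R[i]) :
  (forall c x y, f (c *: x + y) = c * f x + f y) ->
  (forall x, `|f x| <= M * `|x|) -> exists w, forall x, f x = ip x w.
Proof.
move=> lf fM.
have f0 : f 0 = 0.
  by have := lf (-1) 0 0; rewrite scaler0 addr0 mulN1r addNr.
have fB x y : f (x - y) = f x - f y.
  by rewrite addrC -scaleN1r lf mulN1r addrC.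
have fZ c x : f (c *: x) = c * f x by rewrite -[c *: x]addr0 lf f0 addr0.
pose A := [set x | f x = 0].
have cA : is_closed_subspace A.
  split=> //; last by move=> c x y /= fx fy; rewrite /A/= lf fx fy mulr0 addr0.
  rewrite closure_id; apply/seteqP; split; first exact: subset_closure.
  move=> x clx /=.
  have [->//|x0] := eqVneq x 0; apply/normr0_eq0/eqP; rewrite eq_le normr_ge0 andbT.
  have M0 : 0 <= M.
    by have := le_trans (normr_ge0 _) (fM x); rewrite pmulr_lge0 ?normr_gt0.
  apply/ler_addgt0Pr => e e0; rewrite add0r.
  have M1 : 0 < M + 1 by rewrite ltr_wpDl.
  have [] := clx (ball x (e / (M + 1))); first exact/nbhsx_ballx/divr_gt0.
  move=> y [Ay]; rewrite -ball_normE/= => xy.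
  rewrite -[f x]subr0 -[X in _ - X]Ay -fB (le_trans (fM _))//.
  apply: (@le_trans _ _ ((M + 1) * `|x - y|)); first by rewrite ler_wpM2r// lerDl.
  by rewrite mulrC -ler_pdivlMr// ltW.
have [fx0|] := pselect (forall x, f x = 0).
  by exists 0 => x; rewrite fx0 ip0r.
move/existsNP => [u fu]; have [y Ay yO] := closest_point ip_norm u cA.
pose v := u - y; have fv : f v = f u by rewrite fB Ay subr0.
have fv0 : f v != 0 by rewrite fv; exact/eqP.
have v0 : ip v v != 0.
  apply/eqP => /(ip_eq0 ip_norm) v0; move: fv0; rewrite v0 f0 eqxx//.
exists ((f v / ip v v)^* *: v) => x.
have /yO : A (x - (f x / f v) *: v) by rewrite /A/= fB fZ divfK ?subrr.
rewrite -/v ipBr ipZr => /eqP; rewrite subr_eq0 => /eqP vx.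
have xv : ip x v = f x / f v * ip v v.
  by rewrite ipC vx rmorphM/= conjCK -ipC.
by rewrite ipZr conjCK xv mulrACA mulVf// mulr1 mulrC divfK.
Qed.

Lemma adjoint_exists T :
  exists T' : 'L(H), forall x y, ip (T x) y = ip x (T' y).
Proof.
have /choice[w hw] : forall y, exists w, forall x, ip (T x) y = ip x w.
  move=> y; apply: (@riesz_representation _ (`|T| * `|y|)).
    by move=> c u v; rewrite linearP ipDl ipZl.
  move=> x; rewrite (le_trans (cauchy_schwarz ip_norm _ _))// mulrAC ler_wpM2r//.
  exact: bop_norm_le.
have w_lin : linear w.
  move=> c x y; apply: ip_right_inj => z.
  by rewrite -hw !ipDr !ipZr !hw.
have w_le y : `|w y| <= `|T| * `|y|.
  have [->|wy0] := eqVneq (w y) 0; first by rewrite normr0 mulr_ge0.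
  rewrite -(@ler_pM2r _ `|w y|) ?normr_gt0// -expr2 -ip_norm -hw.
  rewrite (le_trans (real_ler_norm _))//.
    by rewrite hw ip_norm realX// normr_real.
  rewrite (le_trans (cauchy_schwarz ip_norm _ _))// mulrAC ler_wpM2r//.
  exact: bop_norm_le.
have [T' T'E] := bop_of_bounded w_lin w_le.
by exists T' => x y; rewrite hw T'E.
Qed.

Lemma adjP T x y : ip (T x) y = ip x (adj ip T y).
Proof.
rewrite /adj; case: xgetP => [U _ UP|/(_ _)noU]; first exact: UP.
by have [T' T'P] := adjoint_exists T; have := noU T'.
Qed.

Lemma adj_uniq T U : (forall x y, ip (T x) y = ip x (U y)) -> adj ip T = U.
Proof.
by move=> TU; apply/bop_eqP => y; apply: ip_right_inj => x; rewrite -adjP TU.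
Qed.

Lemma adjK T : adj ip (adj ip T) = T.
Proof. by apply: adj_uniq => x y; rewrite ipC -adjP -ipC. Qed.

Lemma adjM T U : adj ip (T * U) = adj ip U * adj ip T.
Proof. by apply: adj_uniq => x y; rewrite !bop_mulE !adjP. Qed.

Lemma adjD T U : adj ip (T + U) = adj ip T + adj ip U.
Proof. by apply: adj_uniq => x y; rewrite !bop_addE ipDl ipDr !adjP. Qed.

Lemma adjZ c T : adj ip (c *: T) = c^* *: adj ip T.
Proof.
apply: adj_uniq => x y.
by rewrite !bop_scaleE ipZl ipZr conjCK adjP.
Qed.

Lemma adj1 : adj ip 1 = 1.
Proof. by apply: adj_uniq => x y; rewrite !bop_oneE. Qed.

Lemma adjN T : adj ip (- T) = - adj ip T.
Proof. by rewrite -scaleN1r adjZ rmorphN rmorph1 scaleN1r. Qed.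

Lemma adjB T U : adj ip (T - U) = adj ip T - adj ip U.
Proof. by rewrite adjD adjN. Qed.

Lemma adj_involution : ring_involution (adj ip : 'L(H) -> 'L(H)).
Proof. by split; [exact: adjD | exact: adjM | exact: adjK]. Qed.

Lemma oprojP A : is_closed_subspace A ->
  [/\ oproj ip A * oproj ip A = oproj ip A, adj ip (oproj ip A) = oproj ip A &
      range (oproj ip A) = A].
Proof.
move=> cA; rewrite /oproj; case: xgetP => [P _ PP|noP]; first exact: PP.
have [P [PP Psa rP]] := orthogonal_projection_exists cA.
by case: (noP P); split=> //; exact: adj_uniq.
Qed.

Lemma idem_mulP T U : T * T = T -> (T * U = U) <-> (forall x, range T (U x)).
Proof.
move=> TT; split=> [TU x|TU]; first by exists (U x) => //; rewrite -[in RHS]TU.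
by apply/bop_eqP => x; have [y _ Uy] := TU x; rewrite bop_mulE -Uy -bop_mulE TT.
Qed.

Lemma idem_mul T U : T * T = T -> range U `<=` range T -> T * U = U.
Proof. by move=> TT UT; apply/idem_mulP => // x; apply: UT; exists x. Qed.

Lemma oproj_uniq A P : P * P = P -> adj ip P = P -> range P = A ->
  oproj ip A = P.
Proof.
move=> PP Psa rP.
suff : [/\ oproj ip A * oproj ip A = oproj ip A,
    adj ip (oproj ip A) = oproj ip A & range (oproj ip A) = A].
  case=> QQ Qsa rQ.
  have PQ : P * oproj ip A = oproj ip A by apply: idem_mul; rewrite ?rP ?rQ.
  have QP : oproj ip A * P = P by apply: idem_mul; rewrite ?rP ?rQ.
  by rewrite -PQ -{1}Psa -{1}Qsa -adjM QP Psa.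
rewrite /oproj; case: xgetP => [U _ UP|noU]; first exact: UP.
by case: (noU P).
Qed.
End Adjoint.

(** * Continuity of products and adjoints *)

Section OperatorTopology.
Context {R : realType} {H : completeNormedModType R[i]}.
Variable ip : {dot H for conjC}.
Hypothesis ip_norm : forall x : H, ip x x = `|x| ^+ 2.
Implicit Types (T U : 'L(H)).

Lemma bop_normM T U : `|T * U| <= `|T| * `|U|.
Proof.
apply: opnorm_le => [|x x1]; first exact: mulr_ge0.
rewrite bop_mulE (le_trans (bop_norm_le _ _))// ler_wpM2l//.
exact: opnorm_ge.
Qed.

(** |T* x|^2 = <T T* x, x> <= |T| |T* x| |x|. *)
Lemma adj_norm_le T : `|adj ip T| <= `|T|.
Proof.
apply: opnorm_le => // x x1; set y := adj ip T x.
have [->|y0] := eqVneq y 0; first by rewrite normr0.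
rewrite -(@ler_pM2r _ `|y|) ?normr_gt0// -expr2 -ip_norm -adjP//.
rewrite (le_trans (real_ler_norm _))//.
  by rewrite adjP// ip_norm realX// normr_real.
rewrite (le_trans (cauchy_schwarz ip_norm _ _))//.
by rewrite (le_trans (ler_piMr _ x1))// bop_norm_le.
Qed.

Lemma continuous_mulop (X : topologicalType) (f g : X -> 'L(H)) :
  continuous f -> continuous g -> continuous (fun x => f x * g x).
Proof.
move=> cf cg x; apply/cvgrPdist_le => e e0.
have e2 : 0 < e / 2 by rewrite divr_gt0.
have F1 : 0 < `|f x| + 1 by rewrite ltr_wpDl.
have G1 : 0 < `|g x| + 1 by rewrite ltr_wpDl.
near=> t.
have -> : f x * g x - f t * g t = (f x - f t) * g t + f x * (g x - g t).
  by rewrite mulrBl mulrBr [RHS]addrC addrA subrK.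
rewrite [e]splitr (le_trans (ler_normD _ _))// lerD//.
  apply: le_trans (bop_normM _ _) _.
  apply: (@le_trans _ _ (`|f x - f t| * (`|g x| + 1))).
    rewrite ler_wpM2l// -[g t](subKr (g x)) (le_trans (ler_normB _ _))// lerD2l.
    by near: t; apply: cvgr_dist_le => //; exact: cg.
  rewrite -ler_pdivlMr//; near: t.
  by apply: cvgr_dist_le; [exact: cf | exact: divr_gt0].
apply: le_trans (bop_normM _ _) _.
apply: (@le_trans _ _ ((`|f x| + 1) * `|g x - g t|)).
  by rewrite ler_wpM2r// lerDl.
rewrite mulrC -ler_pdivlMr//; near: t.
by apply: cvgr_dist_le; [exact: cg | exact: divr_gt0].
Unshelve. all: by end_near. Qed.

Lemma continuous_adj (X : topologicalType) (f : X -> 'L(H)) :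
  continuous f -> continuous (fun x => adj ip (f x)).
Proof.
move=> cf x; apply/cvgrPdist_lt => e e0.
have := cf x; move/cvgrPdist_lt => /(_ e e0); apply: filterS => t.
by apply: le_lt_trans; rewrite -adjB// adj_norm_le.
Qed.
End OperatorTopology.

(** * Ranges and J-adjoints *)

Section KreinGeometry.
Context {R : realType} {H : completeNormedModType R[i]}.
Variable ip : {dot H for conjC}.
Hypothesis ip_norm : forall x : H, ip x x = `|x| ^+ 2.
Variable J : 'L(H).
Hypothesis J_symmetry : is_symmetry ip J.
Implicit Types (x y z : H) (A M S : set H) (T U P Q : 'L(H)).

Local Notation adj := (adj ip).
Local Notation sharp := (jadj ip J).

Let adjJ : adj J = J. Proof. by case: J_symmetry. Qed.
Let JJ : J * J = 1. Proof. by case: J_symmetry. Qed.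

Lemma sharpD T U : sharp (T + U) = sharp T + sharp U.
Proof. by rewrite /jadj adjD// mulrDr mulrDl. Qed.

Lemma sharpM T U : sharp (T * U) = sharp U * sharp T.
Proof. by rewrite /jadj adjM// !mulrA -(mulrA _ J J) JJ mulr1. Qed.

Lemma sharpK : involutive sharp.
Proof.
move=> T; rewrite /jadj !adjM// adjJ adjK// !mulrA JJ mul1r.
by rewrite -mulrA JJ mulr1.
Qed.

Lemma sharp_involution : ring_involution sharp.
Proof.
by split; [exact: sharpD | exact: sharpM | exact: sharpK].
Qed.

Lemma jform_sharp T x y : jform ip J (T x) y = jform ip J x (sharp T y).
Proof.
by rewrite /jform !adjP// adjJ -!bop_mulE !mulrA JJ mul1r.
Qed.

Lemma jform_eq0 x : (forall y, jform ip J x y = 0) -> x = 0.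
Proof.
move=> x0; have Jx0 : J x = 0 by apply: (ip_eq0 ip_norm); exact: x0.
by rewrite -[x]bop_oneE -JJ bop_mulE Jx0 linear0.
Qed.

Lemma bopB T x y : T (x - y) = T x - T y. Proof. exact: linearB. Qed.
Lemma bop0 x : (0 : 'L(H)) x = 0. Proof. by []. Qed.
Lemma bopD T x y : T (x + y) = T x + T y. Proof. exact: linearD. Qed.

Lemma range_idem T : T * T = T -> range T = [set x | T x = x].
Proof.
move=> TT; apply/seteqP; split=> [_ [x _ <-]|x /= Tx]; last by exists x.
by rewrite /= -bop_mulE TT.
Qed.

Lemma range_idem_closed T : T * T = T -> is_closed_subspace (range T).
Proof.
move=> TT; rewrite range_idem//; split=> /=.
- rewrite (_ : [set x | T x = x] = (T - 1) @^-1` [set 0]).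
    apply: closed_comp; last first.
      by apply: accessible_closed_set1; exact/hausdorff_accessible/norm_hausdorff.
    by move=> x _; exact: bop_continuous.
  have T1 x : (T - 1) x = T x - x by [].
  apply/seteqP; split=> x Tx.
    by change ((T - 1) x = 0); rewrite T1 (Tx : T x = x) subrr.
  have : (T - 1) x = 0 by exact: Tx.
  by rewrite T1 => /eqP; rewrite subr_eq0 => /eqP.
- exact: linear0.
- by move=> c x y Tx Ty; rewrite linearP/= Tx Ty.
Qed.

Lemma jortho_range T : jortho ip J (range T) = [set x | sharp T x = 0].
Proof.
apply/seteqP; split=> [x h|x Tx _ [y _ <-]].
  apply: jform_eq0 => y; rewrite (jform_sharp (sharp T)) sharpK; apply: h.
  by exists y.
rewrite -[T]sharpK -(jform_sharp (sharp T)) (Tx : sharp T x = 0).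
by rewrite /jform linear0 ip0l.
Qed.

(** Two idempotents with the same range absorb each other on the left; the
    J-adjoint of this relation exchanges them. *)
Lemma jproj_uniq M E : E * E = E -> sharp E = E -> range E = M ->
  jproj ip J M = E.
Proof.
move=> EE Es rE; rewrite /jproj.
case: xgetP => [E' _ [EE' Es' rE']|/(_ E)]; last by case.
have E'E : E' * E = E by apply: idem_mul; rewrite ?rE ?rE'.
have EE'' : E * E' = E' by apply: idem_mul; rewrite ?rE ?rE'.
by rewrite -EE'' -{1}Es -{1}Es' -sharpM E'E Es.
Qed.

Section NormalProjection.
Variables (S : set H) (Q : 'L(H)).
Hypothesis QS : normal_projections ip J S Q.

Local Notation E := (partE ip J Q).
Local Notation P := (partP ip J Q).
Local Notation F := (partF ip J Q).

Lemma normal_projection_idem : normal_idem sharp Q.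
Proof. by case: QS => QQ QC _; split. Qed.

Lemma normal_projection_parts : orthogonal_idems E P (sharp P) F.
Proof.
exact: (normal_idem_parts sharp_involution normal_projection_idem).
Qed.

Lemma partE_sharp : sharp E = E.
Proof. exact: (star_selfadj_part sharp_involution). Qed.

Lemma partE_add_partP : E + P = Q.
Proof. exact: selfadj_add_isotropic. Qed.

(** S^[perp] is the kernel of Q^#, so the isotropic part is the set of fixed points
    of Q killed by Q^#. *)
Lemma range_partP : range P = isotropic ip J S.
Proof.
have [QQ QC rQ] := QS; rewrite -rQ /isotropic jortho_range (range_idem QQ).
apply/seteqP; split=> [_ [x _ <-]|x [Qx Q'x]].
  have PE0 : sharp Q * P = 0.
    rewrite mulrA -QC -mulrA mulrBr mulr1 (idem_star sharp_involution)//.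
    by rewrite subrr mulr0.
  split; first by rewrite /mkset -bop_mulE mulrA QQ.
  by rewrite /mkset -bop_mulE PE0.
have PQ : P = Q - Q * sharp Q by rewrite /partP mulrBr mulr1.
exists x => //; rewrite PQ.
have -> : (Q - Q * sharp Q) x = Q x - Q (sharp Q x) by [].
by rewrite (Q'x : sharp Q x = 0) linear0 subr0.
Qed.

Lemma partE_regular : regular ip J (range E).
Proof.
have [[EE _ _ _] _ _ _] := normal_projection_parts.
split; first exact: range_idem_closed.
rewrite jortho_range partE_sharp range_idem//; split.
- apply/seteqP; split=> // x _; exists (E x), (x - E x); split.
  + by rewrite /mkset -bop_mulE EE.
  + by rewrite /mkset bopB -bop_mulE EE subrr.
  + by rewrite addrC subrK.
- apply/seteqP; split=> [x [Ex Ex0]|_ ->]; last by split; exact: linear0.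
  by rewrite -(Ex : E x = x); exact: Ex0.
- move=> m n Em En; rewrite -(Em : E m = m) jform_sharp partE_sharp.
  by rewrite (En : E n = 0) /jform ip0r.
Qed.

Lemma partE_complement : regular_complements ip J S (range E).
Proof.
split; first exact: partE_regular.
have [[EE EP _ _] [PE PP _ _] _ _] := normal_projection_parts.
have [QQ QC rQ] := QS; rewrite -range_partP; split.
- rewrite -rQ; apply/seteqP; split=> x.
    move=> [y _ <-]; exists (E y), (P y); split; [by exists y| by exists y|].
    by rewrite -bop_addE partE_add_partP.
  move=> [_ [_ [[m _ <-] [n _ <-] ->]]]; exists (E m + P n) => //.
  have -> z : Q z = E z + P z by rewrite -bop_addE partE_add_partP.
  by rewrite !bopD -!bop_mulE EE EP PE PP !bop0 addr0 add0r.
- apply/seteqP; split=> [x [[m _ <-] [n _ h]]|_ ->].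
    have : E (E m) = E (P n) by rewrite h.
    by rewrite -!bop_mulE EE EP => ->.
  by split; exists 0 => //; exact: linear0.
- move=> _ _ [m _ <-] [n _ <-]; rewrite jform_sharp partE_sharp -bop_mulE EP.
  exact: ip0r.
Qed.
End NormalProjection.
End KreinGeometry.

(** * The section as an intertwiner *)

Section CrossSection.
Context {R : realType} {H : completeNormedModType R[i]}.
Variable ip : {dot H for conjC}.
Hypothesis ip_norm : forall x : H, ip x x = `|x| ^+ 2.
Variable J : 'L(H).
Hypothesis J_symmetry : is_symmetry ip J.
Implicit Types (x y z : H) (A M S : set H) (T U P Q : 'L(H)).

Local Notation adj := (adj ip).
Local Notation sharp := (jadj ip J).
Local Notation E := (partE ip J).
Local Notation P := (partP ip J).
Local Notation F := (partF ip J).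
Local Notation isotropic := (isotropic ip J).

Let sharp_inv := sharp_involution ip_norm J_symmetry.
Let sM := sharpM ip_norm J_symmetry.
Let adjJ : adj J = J. Proof. by case: J_symmetry. Qed.
Let JJ : J * J = 1. Proof. by case: J_symmetry. Qed.

(** If T projects along something containing the range of U, then T y is the only
    candidate for the projection of y. *)
Lemma proj_along_idem T U y : T * T = T -> T * U = 0 ->
  range U (y - T y) -> proj_along (range T) (range U) y = T y.
Proof.
move=> TT TU Uy; rewrite /proj_along.
case: xgetP => [m _ [[z _ <-] [w _ Uw]]|/(_ (T y))]; last first.
  by case; split=> //; exists y.
have : T (y - T z) = 0 by rewrite -Uw -bop_mulE TU.
by rewrite bopB -bop_mulE TT => /eqP; rewrite subr_eq0 => /eqP.
Qed.

Lemma normal_projections_mul S Q Q' : normal_projections ip J S Q ->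
  normal_projections ip J S Q' -> Q * Q' = Q'.
Proof. by move=> [QQ _ rQ] [_ _ rQ']; apply: idem_mul; rewrite ?rQ ?rQ'. Qed.

Section Pair.
Variables (S : set H) (Q0 Q : 'L(H)).
Hypotheses (Q0S : normal_projections ip J S Q0).
Hypotheses (QS : normal_projections ip J S Q).

Let nQ := normal_projection_idem QS.
Let nQ0 := normal_projection_idem Q0S.
Let QQ0 : Q * Q0 = Q0. Proof. exact: normal_projections_mul QS Q0S. Qed.
Let Q0Q : Q0 * Q = Q. Proof. exact: normal_projections_mul Q0S QS. Qed.

Let PP0 : P Q * P Q0 = P Q0.
Proof. exact: (isotropic_part_mul sharp_inv nQ nQ0 QQ0 Q0Q). Qed.

Let P0P : P Q0 * P Q = P Q.
Proof. exact: (isotropic_part_mul sharp_inv nQ0 nQ Q0Q QQ0). Qed.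

Lemma proj_along_partE x :
  proj_along (range (E Q)) (isotropic S) (E Q0 x) = (E Q * E Q0) x.
Proof.
have [[EE EP _ _] _ _ _] := normal_projection_parts ip_norm J_symmetry QS.
rewrite -(range_partP ip_norm J_symmetry QS) proj_along_idem//.
exists (E Q0 x) => //.
have : Q * E Q0 = E Q0 by rewrite /partE mulrA QQ0.
rewrite -{1}(partE_add_partP ip J Q) mulrDl => e.
apply: (addrI (E Q (E Q0 x))); rewrite [RHS]addrC subrK.
by rewrite -!bop_mulE -bop_addE e.
Qed.

(** F0 has range in S^[perp], the kernel of Q^#, on which 1 = F + P. *)
Lemma proj_along_partF x :
  proj_along (range (F Q)) (isotropic S) (F Q0 x) = (F Q * F Q0) x.
Proof.
have [_ _ _ [_ FP _ FF]] := normal_projection_parts ip_norm J_symmetry QS.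
have [_ QC _] := QS; have [_ Q0C _] := Q0S.
rewrite -(range_partP ip_norm J_symmetry QS) proj_along_idem//.
exists (F Q0 x) => //.
have F0E : F Q0 = (1 - sharp Q0) * (1 - Q0).
  by rewrite /partF (starB1 sharp_inv); apply: comm_compl; apply/esym/comm_compl.
have Q'F0 : sharp Q * F Q0 = 0.
  rewrite F0E mulrA (mulrBr (sharp Q)) mulr1.
  have <- : sharp (Q0 * Q) = sharp Q * sharp Q0 by exact: sM.
  by rewrite Q0Q subrr mul0r.
have := parts_sum1 sharp_inv nQ.
move=> /(congr1 (fun T => T * F Q0)); rewrite mul1r !mulrDl.
rewrite /selfadj_part -(mulrA Q) Q'F0 mulr0 add0r.
have -> : sharp (isotropic_part sharp Q) * F Q0 = 0.
  by rewrite sM -mulrA Q'F0 mulr0.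
rewrite addr0 => e; apply: (addrI (F Q (F Q0 x))); rewrite [RHS]addrC subrK.
by rewrite -!bop_mulE -bop_addE e.
Qed.

(** The argument determines f = P0 x, because P0 kills P0^#, and then P0^# J h,
    hence P^# J h = P^# P0^# J h.  Conversely h = p1 P0* J x is a solution: p1 is
    absorbed by P0*, whose adjoint P0 has its range in S^o. *)
Lemma section_VE x :
  section_V ip J S Q0 Q ((P Q0 + sharp (P Q0)) x)
  = (P Q * P Q0 + sharp (P Q) * sharp (P Q0)) x.
Proof.
rewrite -sM PP0 P0P.
have [_ [_ P0P0 P0P0' _] _ _] := normal_projection_parts ip_norm J_symmetry Q0S.
have rP0 := range_partP ip_norm J_symmetry Q0S.
have cS : is_closed_subspace (isotropic S).
  by rewrite -rP0; exact: range_idem_closed.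
have [p1p1 p1s rp1] := oprojP ip_norm cS; set p1 := oproj ip _ in p1p1 p1s rp1.
rewrite /section_V; case: xgetP => [y _ [f [h [Sf Sh xE ->]]]|].
  have P0f : P Q0 f = f.
    by move: Sf; rewrite -rP0 (range_idem P0P0).
  have fE : f = P Q0 x.
    have := congr1 (P Q0) xE; rewrite bopD P0f -bop_mulE mulrDr P0P0 P0P0' addr0.
    by rewrite -(bop_mulE (P Q0)) P0P0' bop0 addr0 => ->.
  have hE : sharp (P Q0) (J h) = sharp (P Q0) x.
    by apply: (addrI f); rewrite -xE fE bop_addE.
  have P'E : sharp (P Q) = sharp (P Q) * sharp (P Q0) by rewrite -sM P0P.
  by rewrite bop_addE fE P'E !(bop_mulE (sharp (P Q))) hE.
have P0p1 : adj (P Q0) * p1 = adj (P Q0).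
  rewrite -p1s -adjM//; congr (adj _); apply: idem_mul => //.
  by rewrite rp1 rP0.
have PP0a : adj (P Q) * adj (P Q0) = adj (P Q) by rewrite -adjM// P0P.
have Pp1 : adj (P Q) * p1 = adj (P Q) by rewrite -PP0a -mulrA P0p1.
have P0P0a : adj (P Q0) * adj (P Q0) = adj (P Q0) by rewrite -adjM// P0P0.
have sharp_h T : adj T * p1 = adj T -> adj T * adj (P Q0) = adj T ->
    sharp T (J ((p1 * adj (P Q0) * J) x)) = sharp T x.
  move=> Tp1 TP0; have : sharp T * (J * (p1 * adj (P Q0) * J)) = sharp T.
    by rewrite /jadj !mulrA -(mulrA _ J J) JJ mulr1 -(mulrA J _ p1) Tp1
      -(mulrA J) TP0.
  by move=> /(congr1 (fun U : 'L(H) => U x)).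
move=> /(_ ((P Q0 + sharp (P Q)) x)); case.
exists (P Q0 x), ((p1 * adj (P Q0) * J) x); split.
- by rewrite -rP0; exists x.
- by rewrite -rp1; exists ((adj (P Q0) * J) x).
- by rewrite bop_addE sharp_h.
- by rewrite bop_addE sharp_h.
Qed.

Lemma cross_sectionE : cross_section ip J S Q0 Q = intertwiner sharp Q Q0.
Proof.
have spec x : intertwiner sharp Q Q0 x =
    proj_along (range (E Q)) (isotropic S) (E Q0 x)
  + proj_along (range (F Q)) (isotropic S) (F Q0 x)
  + section_V ip J S Q0 Q ((P Q0 + sharp (P Q0)) x).
  by rewrite proj_along_partE proj_along_partF section_VE /intertwiner -addrA.
rewrite /cross_section; case: xgetP => [U _ UE|/(_ _)/(_ spec)//].
by apply/bop_eqP => x; rewrite UE spec.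
Qed.

Lemma cross_section_sharp :
  sharp (cross_section ip J S Q0 Q) = intertwiner sharp Q0 Q.
Proof. by rewrite cross_sectionE (star_intertwiner sharp_inv). Qed.

Lemma cross_section_unitary :
  cross_section ip J S Q0 Q * sharp (cross_section ip J S Q0 Q) = 1 /\
  sharp (cross_section ip J S Q0 Q) * cross_section ip J S Q0 Q = 1.
Proof.
rewrite cross_section_sharp cross_sectionE.
by split; apply: (intertwiner_inv sharp_inv).
Qed.

Lemma cross_section_conj :
  cross_section ip J S Q0 Q * Q0 * sharp (cross_section ip J S Q0 Q) = Q.
Proof.
have [UU _] := cross_section_unitary; rewrite {1}cross_sectionE.
rewrite (intertwiner_comm sharp_inv nQ nQ0) -mulrA.
by rewrite -{1}cross_sectionE UU mulr1.
Qed.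
End Pair.
End CrossSection.

(** * The selection *)

Section Selection.
Context {R : realType} {H : completeNormedModType R[i]}.
Variable ip : {dot H for conjC}.
Hypothesis ip_norm : forall x : H, ip x x = `|x| ^+ 2.
Variable J : 'L(H).
Hypothesis J_symmetry : is_symmetry ip J.
Implicit Types (x y z : H) (A M S : set H) (T U Q : 'L(H)).

Local Notation adj := (adj ip).
Local Notation sharp := (jadj ip J).
Local Notation E := (partE ip J).
Local Notation P := (partP ip J).
Local Notation isotropic := (isotropic ip J).

Let sM := sharpM ip_norm J_symmetry.
Let adjJ : adj J = J. Proof. by case: J_symmetry. Qed.
Let JJ : J * J = 1. Proof. by case: J_symmetry. Qed.

Lemma ortho_range T : Defs.ortho ip (range T) = [set x | adj T x = 0].
Proof.
apply/seteqP; split=> [x h|x Tx _ [y _ <-]].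
  apply: (ip_eq0 ip_norm); rewrite (adjP ip_norm) adjK//.
  by apply: h; exists (adj T x).
by rewrite ipC (adjP ip_norm) (Tx : adj T x = 0) ip0r rmorph0.
Qed.

Lemma bop_scaleAl c T U : c *: (T * U) = (c *: T) * U.
Proof. exact/bop_eqP. Qed.

Lemma bop_scaleAr c T U : c *: (T * U) = T * (c *: U).
Proof. by apply/bop_eqP => x; rewrite bop_mulE [in RHS]bop_scaleE linearZ. Qed.

Section Blocks.
Variables (S : set H) (Q : 'L(H)).
Hypothesis QS : normal_projections ip J S Q.

Local Notation p1 := (oproj ip (isotropic S)).
Local Notation p2 := (oproj ip (S `&` Defs.ortho ip (isotropic S))).
Local Notation pS := (oproj ip S).

Let tab := normal_projection_parts ip_norm J_symmetry QS.
Let EE : E Q * E Q = E Q. Proof. by case: tab => -[]. Qed.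
Let EP : E Q * P Q = 0. Proof. by case: tab => -[]. Qed.
Let PP : P Q * P Q = P Q. Proof. by case: tab => _ []. Qed.
Let rP : range (P Q) = isotropic S. Proof. exact: range_partP. Qed.
Let QQ : Q * Q = Q. Proof. by case: QS. Qed.
Let rQ : range Q = S. Proof. by case: QS. Qed.

Let S_closed : is_closed_subspace S.
Proof. by rewrite -rQ; exact: range_idem_closed. Qed.

Let iso_closed : is_closed_subspace (isotropic S).
Proof. by rewrite -rP; exact: range_idem_closed. Qed.

Lemma oproj_isotropic : [/\ p1 * p1 = p1, adj p1 = p1 & range p1 = isotropic S].
Proof. exact: (oprojP ip_norm iso_closed). Qed.

Lemma oproj_S : [/\ pS * pS = pS, adj pS = pS & range pS = S].
Proof. exact: (oprojP ip_norm S_closed). Qed.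

Let p11 : p1 * p1 = p1. Proof. by case: oproj_isotropic. Qed.
Let p1s : adj p1 = p1. Proof. by case: oproj_isotropic. Qed.
Let rp1 : range p1 = isotropic S. Proof. by case: oproj_isotropic. Qed.
Let pSS : pS * pS = pS. Proof. by case: oproj_S. Qed.
Let pSs : adj pS = pS. Proof. by case: oproj_S. Qed.
Let rpS : range pS = S. Proof. by case: oproj_S. Qed.

Let pSp1 : pS * p1 = p1.
Proof. by apply: idem_mul; rewrite ?rpS ?rp1// => x []. Qed.

Let p1pS : p1 * pS = p1.
Proof. by have := congr1 adj pSp1; rewrite adjM// p1s pSs. Qed.

Lemma oproj_middle : p2 = pS - p1.
Proof.
have d2 : (pS - p1) * (pS - p1) = pS - p1.
  by rewrite mulrBl !mulrBr pSS pSp1 p1pS p11 subrr subr0.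
apply: oproj_uniq => //; first by rewrite adjB// pSs p1s.
have dE x : (pS - p1) x = pS x - p1 x by [].
have -> : S `&` Defs.ortho ip (isotropic S)
    = range pS `&` Defs.ortho ip (range p1) by rewrite rpS rp1.
rewrite (range_idem d2) ortho_range p1s (range_idem pSS).
apply/seteqP; split=> [x dx|x [Sx p1x]].
  split.
    rewrite /mkset -(dx : (pS - p1) x = x) -bop_mulE.
    by rewrite mulrBr pSS pSp1.
  rewrite /mkset -(dx : (pS - p1) x = x) -bop_mulE.
  by rewrite mulrBr p1pS p11 subrr.
by rewrite /mkset dE (Sx : pS x = x) (p1x : p1 x = 0) subr0.
Qed.

Let p12S : p1 + p2 = pS.
Proof. by rewrite oproj_middle addrC subrK. Qed.

Lemma oproj_ortho : oproj ip (Defs.ortho ip S) = 1 - (p1 + p2).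
Proof.
have d2 := idem_compl pSS.
rewrite p12S; apply: oproj_uniq => //; first by rewrite adjB// adj1// pSs.
have dE x : (1 - pS) x = x - pS x by [].
rewrite (range_idem d2) -[in RHS]rpS ortho_range pSs.
apply/seteqP; split=> x.
  by rewrite /mkset dE => /eqP; rewrite -[X in _ == X]subr0 (inj_eq (addrI _))
   eqr_opp => /eqP.
by rewrite /mkset dE => ->; rewrite subr0.
Qed.

Lemma oproj_image : oproj ip (J @` isotropic S) = J * p1 * J.
Proof.
apply: oproj_uniq => //.
- by rewrite !mulrA -(mulrA _ J J) JJ mulr1 -(mulrA J) p11.
- by rewrite !adjM// adjJ p1s mulrA.
rewrite -[in RHS]rp1; apply/seteqP; split=> [_ [x _ <-]|_ [_ [x _ <-] <-]].
  by exists (p1 (J x)) => //; exists (J x).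
exists (J x) => //; have : J * p1 * J * J = J * p1 by rewrite -mulrA JJ mulr1.
by move=> /(congr1 (fun T : 'L(H) => T x)).
Qed.

Let p22 : p2 * p2 = p2.
Proof. by rewrite oproj_middle mulrBl !mulrBr pSS pSp1 p1pS p11 subrr subr0. Qed.
Let p12 : p1 * p2 = 0.
Proof. by rewrite oproj_middle mulrBr p1pS p11 subrr. Qed.
Let p21 : p2 * p1 = 0.
Proof. by rewrite oproj_middle mulrBl pSp1 p11 subrr. Qed.
Let p2s : adj p2 = p2.
Proof. by rewrite oproj_middle adjB// pSs p1s. Qed.

Let Pp1 : P Q * p1 = p1.
Proof. by apply: idem_mul; rewrite ?rP ?rp1. Qed.

Let QpS : Q * pS = pS.
Proof. by apply: idem_mul; rewrite ?rQ ?rpS. Qed.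

Let pSQ : pS * Q = Q.
Proof. by apply: idem_mul; rewrite ?rQ ?rpS. Qed.

Let p1JpS : p1 * J * pS = 0.
Proof.
have P'Q : sharp (P Q) * Q = 0.
  have [_ _ [P'E P'P _ _] _] := tab.
  by rewrite -{2}(partE_add_partP ip J Q) mulrDr P'E P'P addr0.
have PJQ : adj (P Q) * J * Q = 0.
  rewrite -[adj (P Q)]mul1r -JJ -!mulrA !mulrA -(mulrA J J) -(mulrA J).
  by rewrite -(mulrA J) P'Q mulr0.
have p1P : p1 * adj (P Q) = p1.
  by have := congr1 adj Pp1; rewrite adjM// p1s.
by rewrite -QpS -p1P !mulrA -(mulrA p1) -(mulrA p1) PJQ mulr0 mul0r.
Qed.

Let J11 : p1 * J * p1 = 0.
Proof. by rewrite -[X in _ * X]pSp1 mulrA p1JpS mul0r. Qed.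

Let J12 : p1 * J * p2 = 0.
Proof. by rewrite oproj_middle mulrBr p1JpS J11 subrr. Qed.

Let Es : J * adj (E Q) * J = E Q.
Proof. exact: partE_sharp. Qed.

Let pE : (p1 + p2) * E Q = E Q.
Proof. by rewrite p12S /partE mulrA pSQ. Qed.

Let E1 : E Q * p1 = 0.
Proof. by rewrite -Pp1 mulrA EP mul0r. Qed.

Let E2 : p2 * E Q * p2 = p2.
Proof.
have p2P : p2 * P Q = 0.
  have : p1 * P Q = P Q by apply: idem_mul; rewrite ?rP ?rp1.
  by move=> <-; rewrite mulrA p21 mul0r.
have QEP : E Q = Q - P Q by rewrite -{2}(partE_add_partP ip J Q) addrK.
have Qp2 : Q * p2 = p2 by rewrite oproj_middle mulrBr QpS -pSp1 mulrA QpS.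
by rewrite QEP mulrBr p2P subr0 -mulrA Qp2 p22.
Qed.

Let binvP := binv_spec (adj_involution ip_norm) JJ adjJ p22 p1s p2s J12 Es pE E2.

Lemma block_binvE : block_binv ip J S = p2 * E Q * J * p2.
Proof.
have [Bm Bl Br] := binvP; rewrite /block_binv /block_b.
case: xgetP => [B _ [Bm' Bl' _]|/(_ (p2 * E Q * J * p2))]; last by case.
exact: (corner_inverse_uniq p22 Bm' Bl' Bm Br).
Qed.

(** The coefficient that turns the first two summands of the upper right block
    into T' (k rho + c). *)
Definition cubic_half (b : 'L(H)) : 'L(H) := b - 2^-1 *: (b * b * b).

Lemma cubic_half2 b : cubic_half b + cubic_half b = b + b - b * b * b.
Proof.
have half2 : 2^-1 + 2^-1 = 1 :> R[i].
  by rewrite [RHS]splitr mul1r.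
by rewrite /cubic_half addrACA -opprD -scalerDl half2 scale1r.
Qed.

Lemma adj_cubic_half b : adj b = b -> adj (cubic_half b) = cubic_half b.
Proof.
move=> bs; rewrite /cubic_half adjB// adjZ// !adjM// !bs mulrA.
by rewrite fmorphV rmorph_nat.
Qed.

(** Since a a* = p1 and rho = rho a* a, the block formula for the selection
    becomes the expression of [selection_spec] with k = b - b^3 / 2. *)
Lemma selection_expand : selection ip J S (range (E Q)) =
  p1 + p2 + (p1 * E Q * J * p2) *
    (cubic_half (p2 * J * p2) * (p2 * E Q * (J * p1 * J))
     + p2 * J * (1 - (p1 + p2)))
  + (p2 * E Q * J * p2 * (p2 * J * (1 - (p1 + p2))) + p2 * E Q * (J * p1 * J)).
Proof.
have jE : jproj ip J (range (E Q)) = E Q.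
  by apply: jproj_uniq => //; exact: partE_sharp.
have rsr := row_star_rho (adj_involution ip_norm) JJ adjJ p11 p1s p2s J11 J12 Es.
have rrr := rho_star_row (adj_involution ip_norm) (E Q) JJ adjJ p11 p1s J11 J12.
rewrite /selection block_binvE /block_a /block_b /block_c /rho jE oproj_image.
rewrite oproj_ortho rsr; set r := p2 * E Q * (J * p1 * J) in rrr *.
set a := p1 * J * _ in rrr *; set c := p2 * J * (1 - _).
set b := p2 * J * p2; set t := p1 * E Q * J * p2.
congr (_ + _ + _).
rewrite -(mulrA _ r) -(mulrA _ (r * adj a)) rrr !exprSr expr0 mul1r.
rewrite -mulrA bop_scaleAr bop_scaleAl -mulrN -mulrDr; congr (t * _).
by rewrite /cubic_half mulrBl addrC [c + _]addrC addrAC.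
Qed.

(** S is the range of p1 + p2, which is absorbed by the selection on both sides,
    so the selection has range S. *)
Lemma selection_in_part :
  normal_projections ip J S (selection ip J S (range (E Q))) /\
  E (selection ip J S (range (E Q))) = E Q.
Proof.
have bs : adj (p2 * J * p2) = p2 * J * p2 by rewrite !adjM// p2s adjJ mulrA.
have [] := selection_spec (adj_involution ip_norm) JJ adjJ p11 p22 p12 p21 p1s p2s
  J11 J12 EE Es pE E1 E2 (adj_cubic_half bs) (cubic_half2 _).
rewrite -selection_expand p12S; set G := selection _ _ _ _ => GG pG Gp GGs GsG.
split; last exact: GGs.
split=> //; first by rewrite -[LHS]/(G * (J * adj G * J)) GGs -GsG.
apply/seteqP; split; last first.
  move=> x Sx; have : range pS x by rewrite rpS.
  by move=> [y _ <-]; exists (pS y); rewrite // -bop_mulE Gp.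
move=> _ [x _ <-]; have : range pS (G x).
  by exists (G x); rewrite // -bop_mulE pG.
by rewrite rpS.
Qed.

End Blocks.
End Selection.

(** * The conjugations between the sheets *)

Section Covering.
Context {R : realType} {H : completeNormedModType R[i]}.
Variable ip : {dot H for conjC}.
Hypothesis ip_norm : forall x : H, ip x x = `|x| ^+ 2.
Variable J : 'L(H).
Hypothesis J_symmetry : is_symmetry ip J.
Implicit Types (x y z : H) (A M S : set H) (T U V Q : 'L(H)).

Local Notation sharp := (jadj ip J).
Local Notation E := (partE ip J).
Local Notation part := (normal_projections_part ip J).

Let sharp_inv := sharp_involution ip_norm J_symmetry.
Let sM := sharpM ip_norm J_symmetry.
Let sK := sharpK ip_norm J_symmetry.

Lemma range_eq T U : T * U = U -> U * T = T -> range T = range U.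
Proof.
move=> TU UT; apply/seteqP; split=> _ [x _ <-].
  by exists (T x) => //; rewrite -bop_mulE UT.
by exists (U x) => //; rewrite -bop_mulE TU.
Qed.

Lemma unitary_conjM V T U : sharp V * V = 1 ->
  V * T * sharp V * (V * U * sharp V) = V * (T * U) * sharp V.
Proof.
move: (sharp V) => W WV.
by rewrite !mulrA -(mulrA _ W V) WV mulr1.
Qed.

Lemma unitary_conj_sharp V T : sharp (V * T * sharp V) = V * sharp T * sharp V.
Proof. rewrite (sM (V * T)) (sM V) sK; exact: mulrA. Qed.

(** Conjugation by V preserves products and the J-adjoint, hence the algebraic
    relations.  Ranges are compared through Q1 and Q2: idempotents with the same
    range absorb each other, and this survives conjugation. *)
Lemma unitary_conj_part S Q1 Q2 V Q : sharp V * V = 1 ->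
  normal_projections ip J S Q1 -> normal_projections ip J S Q2 ->
  V * Q1 * sharp V = Q2 -> part S (range (E Q1)) Q ->
  part S (range (E Q2)) (V * Q * sharp V).
Proof.
move=> VV Q1S Q2S VQ1 [QS rE].
have conj_range T T' : T * T' = T' -> T' * T = T ->
    range (V * T * sharp V) = range (V * T' * sharp V).
  by move=> TT' T'T; apply: range_eq; rewrite unitary_conjM// ?TT' ?T'T.
have EQ1 : V * E Q1 * sharp V = E Q2.
  by rewrite -VQ1 /partE unitary_conj_sharp unitary_conjM.
have [QQ QC rQ] := QS; split; first split.
- by rewrite unitary_conjM// QQ.
- by rewrite unitary_conj_sharp !unitary_conjM// QC.
- have [_ _ <-] := Q2S; rewrite -VQ1; apply: conj_range.
    exact: (normal_projections_mul QS Q1S).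
  exact: (normal_projections_mul Q1S QS).
rewrite unitary_conj_sharp unitary_conjM// -EQ1; apply: conj_range.
  apply: idem_mul; last by rewrite rE.
  by have [[-> _ _ _] _ _ _] := normal_projection_parts ip_norm J_symmetry QS.
apply: idem_mul; last by rewrite rE.
by have [[-> _ _ _] _ _ _] := normal_projection_parts ip_norm J_symmetry Q1S.
Qed.

(** A part Q_{S,M} with an element Q has E = Q Q^# as the projection onto M, from
    which the selection at M is computed. *)
Lemma sheet_conjugation S M M0 Q0 : part S M0 Q0 -> part S M !=set0 ->
  let U := cross_section ip J S Q0 (selection ip J S M) in
  [/\ U * sharp U = 1, sharp U * U = 1,
      forall Q, part S M0 Q -> part S M (U * Q * sharp U) &
      forall Q, part S M Q -> part S M0 (sharp U * Q * U)].
Proof.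
move=> [Q0S <-] [Q1 [Q1S <-]] U.
have [GS EG] := selection_in_part ip_norm J_symmetry Q1S.
have [UU' U'U] := cross_section_unitary ip_norm J_symmetry Q0S GS.
have UQ0 := cross_section_conj ip_norm J_symmetry Q0S GS.
split=> // Q Qp.
  by rewrite -[Q1 * _]/(E Q1) -EG; exact: (unitary_conj_part U'U Q0S GS).
have := @unitary_conj_part S _ Q0 (sharp U) Q _ GS Q0S.
rewrite sK EG; apply => //.
rewrite -UQ0 -/U; move: (sharp U) U'U => W WU.
by rewrite !mulrA WU mul1r -mulrA WU mulr1.
Qed.

Lemma continuous_addop (X : topologicalType) (f g : X -> 'L(H)) :
  continuous f -> continuous g -> continuous (fun u => f u + g u).
Proof. by move=> cf cg u; apply: cvgD; [exact: cf | exact: cg]. Qed.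

Lemma continuous_subop (X : topologicalType) (f g : X -> 'L(H)) :
  continuous f -> continuous g -> continuous (fun u => f u - g u).
Proof. by move=> cf cg u; apply: cvgB; [exact: cf | exact: cg]. Qed.

Lemma continuous_sharp (X : topologicalType) (f : X -> 'L(H)) :
  continuous f -> continuous (fun u => sharp (f u)).
Proof.
move=> cf; apply: continuous_mulop; last by move=> u; exact: cst_continuous.
apply: continuous_mulop; first by move=> u; exact: cst_continuous.
exact: (continuous_adj ip_norm cf).
Qed.

Lemma continuous_intertwiner (X : topologicalType) (f g : X -> 'L(H)) :
  continuous f -> continuous g ->
  continuous (fun u => intertwiner sharp (f u) (g u)).
Proof.
move=> cf cg; have c1 : continuous (fun _ : X => 1 : 'L(H)).
  by move=> u; exact: cst_continuous.
have cE (h : X -> 'L(H)) : continuous h ->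
    continuous (fun u => selfadj_part sharp (h u)).
  by move=> ch; exact: continuous_mulop ch (continuous_sharp ch).
have cP (h : X -> 'L(H)) : continuous h ->
    continuous (fun u => isotropic_part sharp (h u)).
  move=> ch; rewrite /isotropic_part; apply: continuous_mulop => //.
  apply: continuous_subop => //.
  exact: continuous_sharp.
have cF (h : X -> 'L(H)) : continuous h ->
    continuous (fun u => coselfadj_part sharp (h u)).
  move=> ch; rewrite /coselfadj_part; apply: continuous_mulop.
    exact: continuous_subop.
  by apply: continuous_sharp; exact: continuous_subop.
rewrite /intertwiner; apply: continuous_addop; last first.
  by apply: continuous_mulop; apply: continuous_sharp; exact: cP.
apply: continuous_addop; last by apply: continuous_mulop; exact: cP.
apply: continuous_addop; first by apply: continuous_mulop; exact: cE.
by apply: continuous_mulop; exact: cF.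
Qed.

Lemma continuous_conjugation (V W : 'L(H)) :
  continuous (fun T : 'L(H) => V * T * W).
Proof.
have cst (U : 'L(H)) : continuous (fun _ : 'L(H) => U).
  by move=> T; exact: cst_continuous.
have cid : continuous (fun T : 'L(H) => T) by move=> T; exact: cvg_id.
by do 2! apply: continuous_mulop => //.
Qed.

(** The projection onto M = R(Q Q^#) is Q Q^# itself, so on normal projections the
    selection is a polynomial in Q and its J-adjoint. *)
Lemma continuous_selection S : exists g : 'L(H) -> 'L(H),
  continuous g /\
  forall Q, normal_projections ip J S Q -> g Q = selection ip J S (range (E Q)).
Proof.
set p1 := oproj ip (isotropic ip J S).
set p2 := oproj ip (S `&` Defs.ortho ip (isotropic ip J S)).
exists (fun Q => p1 + p2 + (p1 * E Q * J * p2) *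
    (cubic_half (p2 * J * p2) * (p2 * E Q * (J * p1 * J))
     + p2 * J * (1 - (p1 + p2)))
  + (p2 * E Q * J * p2 * (p2 * J * (1 - (p1 + p2))) + p2 * E Q * (J * p1 * J))).
split; last by move=> Q QS; rewrite (selection_expand ip_norm J_symmetry QS).
have cst (U : 'L(H)) : continuous (fun _ : 'L(H) => U).
  by move=> T; exact: cst_continuous.
have cid : continuous (fun T : 'L(H) => T) by move=> T; exact: cvg_id.
have cE : continuous (fun Q : 'L(H) => E Q).
  by apply: continuous_mulop => //; exact: continuous_sharp.
have cM (V W : 'L(H)) (f : 'L(H) -> 'L(H)) : continuous f ->
    continuous (fun T => V * f T * W).
  by move=> cf; do 2! apply: continuous_mulop => //.
apply: continuous_addop; last first.
  apply: continuous_addop; last exact: cM.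
  do 3! apply: continuous_mulop => //; exact: continuous_mulop.
apply: continuous_addop => //; apply: continuous_mulop.
  by do 3! apply: continuous_mulop => //.
by apply: continuous_addop => //; apply: continuous_mulop => //; exact: cM.
Qed.
End Covering.

(** * The covering *)

Theorem theorem5p6 (R : realType) (H : completeNormedModType R[i])
    (ip : {dot H for conjC}) (ip_norm : forall x : H, ip x x = `|x| ^+ 2)
    (H_separable : separable H)
    (J : 'L(H)) (J_symmetry : is_symmetry ip J)
    (S : set H) (S_pseudo_regular : pseudo_regular ip J S)
    (M0 : set H) (M0_regular : regular ip J M0)
    (S_M0 : jdirect_sum ip J S M0 (isotropic ip J S))
    (Q0 : 'L(H)) (Q0_M0 : normal_projections_part ip J S M0 Q0)
    (r : 'L(H) -> 'L(H))
    (rE : forall M Q, regular_complements ip J S M ->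
       normal_projections_part ip J S M Q ->
       r Q = jadj ip J (cross_section ip J S Q0 (selection ip J S M)) * Q
             * cross_section ip J S Q0 (selection ip J S M)) :
  covering_map (normal_projections ip J S)
    [set normal_projections_part ip J S M | M in regular_complements ip J S]
    (normal_projections_part ip J S M0) r.
Proof.
set QS := normal_projections ip J S.
set part := normal_projections_part ip J S.
set U := fun M => cross_section ip J S Q0 (selection ip J S M).
pose M_ Q := range (partE ip J Q).
have Q0S : QS Q0 by case: Q0_M0.
have compl Q : QS Q -> regular_complements ip J S (M_ Q).
  exact: (partE_complement ip_norm J_symmetry).
have sheet M : part M !=set0 -> [/\ U M * jadj ip J (U M) = 1,
    jadj ip J (U M) * U M = 1,
    forall Q, part M0 Q -> part M (U M * Q * jadj ip J (U M)) &
    forall Q, part M Q -> part M0 (jadj ip J (U M) * Q * U M)].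
  exact: (sheet_conjugation ip_norm J_symmetry Q0_M0).
have rM M Q : part M Q -> r Q = jadj ip J (U M) * Q * U M.
  move=> QM; apply: rE => //; case: QM => QQS <-; exact: compl.
have r_cont : {within QS, continuous r}.
  have [G [G_cont GE]] := continuous_selection ip_norm J_symmetry S.
  (* r' is r written without reference to M. *)
  pose r' Q := intertwiner (jadj ip J) Q0 (G Q) * Q
    * intertwiner (jadj ip J) (G Q) Q0.
  apply: (@subspace_eq_continuous _ _ _ r').
    move=> Q /set_mem QQS; symmetry; apply: etrans (rM (M_ Q) Q _) _ => //.
    rewrite /r' GE//.
    have [GS _] := selection_in_part ip_norm J_symmetry QQS.
    by rewrite /U (cross_section_sharp ip_norm J_symmetry Q0S GS)
      (cross_sectionE ip_norm J_symmetry Q0S GS).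
  apply: continuous_subspaceT.
  have cid : continuous (fun T : 'L(H) => T) by move=> T; exact: cvg_id.
  have cst : continuous (fun _ : 'L(H) => Q0) by move=> T; exact: cst_continuous.
  apply: continuous_mulop; first apply: continuous_mulop => //.
    exact: continuous_intertwiner.
  exact: continuous_intertwiner.
have part_M M Q : part M Q -> M = M_ Q by case.
split=> //.
- apply/seteqP; split=> [_ [Q QQS <-]|Q QM0].
    have QM : part (M_ Q) Q by [].
    rewrite (rM _ _ QM); have [_ _ _] := sheet _ (ex_intro _ Q QM); exact.
  have [_ U'U UQ _] := sheet _ (ex_intro _ Q QM0).
  exists (U M0 * Q * jadj ip J (U M0)); first by case: (UQ _ QM0).
  rewrite (rM _ _ (UQ _ QM0)); move: (jadj _ _ _) U'U => W WU.
  by rewrite !mulrA WU mul1r -mulrA WU mulr1.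
- move=> Q QM0; exists (part M0); split=> //.
    by exists setT; [exact: openT | rewrite setIT].
  (* The sheets are indexed by the M for which Q_{S,M} has an element, which
     supplies the projection onto M. *)
  exists {M | part M !=set0}, (fun i => part (proj1_sig i)); split.
  + move=> [M [Q' Q'M]]; exists (part M).
      by exists M => //; rewrite (part_M _ _ Q'M); apply: compl; case: Q'M.
    by exists setT; [exact: openT | rewrite setIT].
  + move=> [M hM] [N hN] _ _ [Q' /= [Q'M Q'N]].
    apply: eq_exist; rewrite (part_M _ _ Q'M) (part_M _ _ Q'N)//.
  + apply/seteqP; split=> [Q' [/= Q'S _]|Q' [[M hM] _ /= Q'M]].
      have Q'M : part (M_ Q') Q' by [].
      by exists (exist (fun M => part M !=set0) (M_ Q') (ex_intro _ Q' Q'M)).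
    split; first by case: Q'M.
    by rewrite /preimage/= (rM _ _ Q'M); have [_ _ _] := sheet _ hM; exact.
  + move=> [M hM] /=; have [UU' U'U UQ U'Q] := sheet _ hM.
    split.
      by apply: continuous_subspaceW r_cont => Q' [].
    exists (fun Q' => U M * Q' * jadj ip J (U M)); split.
    * apply: continuous_subspaceT; exact: continuous_conjugation.
    * by split=> // Q' Q'M; rewrite (rM _ _ Q'M); exact: U'Q.
    * move=> Q' Q'M; rewrite (rM _ _ Q'M).
      move: (jadj _ _ _) UU' => W UW.
      by rewrite !mulrA UW mul1r -mulrA UW mulr1.
    * move=> Q' Q'M; rewrite (rM _ _ (UQ _ Q'M)).
      move: (jadj _ _ _) U'U => W WU.
      by rewrite !mulrA WU mul1r -mulrA WU mulr1.
Qed.
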